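(* Let $B_{10}$ be the Bayes factor of $H_1:\boldsymbol\theta\neq\mathbf 0$ against $H_0:\boldsymbol\theta=\mathbf 0$ under the conjugate priors, i.e. $$B_{10}=C_1\,\frac{\left(s_1^2\nu_1+s_{\mathbf y}^2+\hat{\boldsymbol\theta}'\big(\mathcal I^{-1}+\boldsymbol\Omega\big)^{-1}\hat{\boldsymbol\theta}\right)^{-(n+\nu_1-r_2)/2}}{\left(s_0^2\nu_0+s_{\mathbf y}^2+\hat{\boldsymbol\theta}'\mathcal I\,\hat{\boldsymbol\theta}\right)^{-(n+\nu_0-r_2)/2}},$$ where $\mathcal I=\mathbf X_{\boldsymbol\theta}'\boldsymbol\Sigma^{-1}\mathbf X_{\boldsymbol\theta}$ and $$C_1=\frac{\kappa_1\,\Gamma\!\left(\frac{n+\nu_1-r_2}{2}\right)}{\kappa_0\,\Gamma\!\left(\frac{n+\nu_0-r_2}{2}\right)}\,2^{(\nu_1-\nu_0)/2}\,\big|\boldsymbol\Omega+\mathcal I^{-1}\big|^{-1/2}\,\big|\mathcal I\big|^{-1/2}.$$ Then, as $|\hat{\boldsymbol\theta}|\to\infty$: (i) if $\nu_0<\nu_1$, then $B_{10}\to 0$; (ii) if $\nu_0>\nu_1$, then $B_{10}\to\infty$; (iii) if $\nu_0=\nu_1=\nu$, then $$\limsup_{|\hat{\boldsymbol\theta}|\to\infty}B_{10}\ \le\ C_1\left(\limsup_{|\hat{\boldsymbol\theta}|\to\infty}\frac{\hat{\boldsymbol\theta}'\mathcal I\,\hat{\boldsymbol\theta}}{\hat{\boldsymbol\theta}'(\mathcal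 I^{-1}+\boldsymbol\Omega)^{-1}\hat{\boldsymbol\theta}}\right)^{(n+\nu-r_2)/2}=C_1(1+\lambda_{\max})^{(n+\nu-r_2)/2}<\infty,$$ where $\lambda_{\max}$ is the largest eigenvalue of $\mathcal I\,\boldsymbol\Omega$.
   Context: Model: $\mathbf y=\mathbf X_{\boldsymbol\theta}\boldsymbol\theta+\mathbf X_{\boldsymbol\gamma}\boldsymbol\gamma+\boldsymbol\epsilon$, $\boldsymbol\epsilon\sim N(\mathbf 0,\sigma^2\boldsymbol\Sigma)$, with $\mathbf y\in\mathbb R^n$, $\boldsymbol\theta\in\mathbb R^{r_1}$ ($r_1\ge1$) the tested parameters, $\boldsymbol\gamma\in\mathbb R^{r_2}$ ($r_2\ge0$) nuisance parameters, $n>r_1+r_2$, $\boldsymbol\Sigma$ a known positive definite matrix, $[\mathbf X_{\boldsymbol\theta}\ \mathbf X_{\boldsymbol\gamma}]$ of full column rank, and the parametrization orthogonal: $\mathbf X_{\boldsymbol\theta}'\boldsymbol\Sigma^{-1}\mathbf X_{\boldsymbol\gamma}=\mathbf 0$. $\hat{\boldsymbol\theta}=(\mathbf X_{\boldsymbol\theta}'\boldsymbol\Sigma^{-1}\mathbf X_{\boldsymbol\theta})^{-1}\mathbf X_{\boldsymbol\theta}'\boldsymbol\Sigma^{-1}\mathbf y$ is the maximum likelihood estimate of $\boldsymbol\theta$ ($\hat{\boldsymbol\gamma}$ is that of $\boldsymbol\gamma$), and $s_{\mathbf y}^2=(\mathbf y-\mathbf X_{\boldsymbol\theta}\hat{\boldsymbol\theta}-\mathbf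 X_{\boldsymbol\gamma}\hat{\boldsymbol\gamma})'\boldsymbol\Sigma^{-1}(\mathbf y-\mathbf X_{\boldsymbol\theta}\hat{\boldsymbol\theta}-\mathbf X_{\boldsymbol\gamma}\hat{\boldsymbol\gamma})$. Conjugate priors: under $H_1$, $\boldsymbol\theta\mid\sigma_1^2\sim N(\mathbf 0,\sigma_1^2\boldsymbol\Omega)$ with $\boldsymbol\Omega$ positive definite, $\pi_1(\boldsymbol\gamma_1)\propto1$, $\sigma_1^2\sim\text{inv-}\chi^2(s_1^2,\nu_1)$; under $H_0$, $\pi_0(\boldsymbol\gamma_0)\propto1$, $\sigma_0^2\sim\text{inv-}\chi^2(s_0^2,\nu_0)$. Here $\nu_t\ge0$, $s_t>0$; $\text{inv-}\chi^2(s^2,\nu)$ has density proportional to $(\sigma^2)^{-\nu/2-1}e^{-\nu s^2/(2\sigma^2)}$, and $\nu=0$ denotes the improper prior $\sigma^{-2}$. $\kappa_t=(\nu_t/2)^{\nu_t/2}s_t^{\nu_t}/\Gamma(\nu_t/2)$ if $\nu_t>0$, and $\kappa_t=1$ if $\nu_t=0$. The limit $|\hat{\boldsymbol\theta}|\to\infty$ is taken with all other quantities ($n$, $\mathbf X_{\boldsymbol\theta}$, $\mathbf X_{\boldsymbol\gamma}$, $\boldsymbol\Sigma$, $\boldsymbol\Omega$, $s_t$, $\nu_t$, $s_{\mathbf y}^2>0$) fixed. *)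

(* Defs.v *)
From HB Require Import structures.
From mathcomp Require Import all_boot all_order all_algebra.
From mathcomp Require Import all_classical all_reals all_analysis.
From mathcomp Require Import ring.

Set Implicit Arguments.
Unset Strict Implicit.
Unset Printing Implicit Defensive.

Import Order.TTheory GRing.Theory Num.Theory.
Import numFieldNormedType.Exports.

Local Open Scope classical_set_scope.
Local Open Scope ring_scope.

Definition qform {R : realType} {k : nat} (A : 'M[R]_k) (x : 'cV[R]_k) : R :=
  (x^T *m A *m x) ord0 ord0.

Definition posdefmx {R : realType} {k : nat} (A : 'M[R]_k) : Prop :=
  A^T = A /\ forall x : 'cV[R]_k, x != 0 -> 0 < qform A x.

Definition l2norm {R : realType} {k : nat} (x : 'cV[R]_k) : R :=
  Num.sqrt (\sum_i x i ord0 ^+ 2).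

(* Only real eigenvalues are considered; this loses nothing for a product of
   two positive definite matrices, whose spectrum is real. *)
Definition largest_eigenvalue {R : realType} {k : nat} (A : 'M[R]_k) (l : R) :
    Prop :=
  eigenvalue A l /\ forall a, eigenvalue A a -> a <= l.

(* Integral over R^k of a nonnegative function, with respect to k-dimensional
   Lebesgue measure, as an iterated integral (Tonelli). *)
Fixpoint lebint {R : realType} (k : nat) : ('cV[R]_k -> \bar R) -> \bar R :=
  match k with
  | 0 => fun f => f 0
  | k'.+1 => fun f =>
      (\int[@lebesgue_measure R]_x
         lebint (fun u : 'cV[R]_k' => f (col_mx (x%:M : 'cV[R]_1) u)))%E
  end.

Definition Gamma {R : realType} (a : R) : R :=
  \int[@lebesgue_measure R]_(t in `]0, +oo[) (t `^ (a - 1) * expR (- t)).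

Definition mvn_pdf {R : realType} {k : nat} (m : 'cV[R]_k) (V : 'M[R]_k)
    (x : 'cV[R]_k) : R :=
  (2 * pi) `^ (- (k%:R / 2)) * (\det V) `^ (- (1 / 2))
  * expR (- (qform (invmx V) (x - m) / 2)).

Definition kappa {R : realType} (s nu : R) : R :=
  if 0 < nu then (nu / 2) `^ (nu / 2) * s `^ nu / Gamma (nu / 2) else 1.

(* Density at v = sigma^2; for nu = 0 it is the improper v^-1. *)
Definition inv_chi2_pdf {R : realType} (s nu v : R) : R :=
  kappa s nu * v `^ (- (nu / 2) - 1) * expR (- (nu * s ^+ 2 / (2 * v))).

Definition fisher_info {R : realType} {n r : nat} (Sigma : 'M[R]_n)
    (X : 'M[R]_(n, r)) : 'M[R]_r :=
  X^T *m invmx Sigma *m X.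

(* With X = Xt (resp. Xg) this is the maximum likelihood estimate of theta
   (resp. gamma) when Xt and Xg are Sigma^-1-orthogonal: see [gls_mle]. *)
Definition gls {R : realType} {n r : nat} (Sigma : 'M[R]_n)
    (X : 'M[R]_(n, r)) (y : 'cV[R]_n) : 'cV[R]_r :=
  invmx (fisher_info Sigma X) *m X^T *m invmx Sigma *m y.

Definition rss {R : realType} {n r1 r2 : nat} (Sigma : 'M[R]_n)
    (Xt : 'M[R]_(n, r1)) (Xg : 'M[R]_(n, r2)) (y : 'cV[R]_n) : R :=
  qform (invmx Sigma) (y - Xt *m gls Sigma Xt y - Xg *m gls Sigma Xg y).

Definition likelihood {R : realType} {n r1 r2 : nat} (Sigma : 'M[R]_n)
    (Xt : 'M[R]_(n, r1)) (Xg : 'M[R]_(n, r2)) (y : 'cV[R]_n)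
    (t : 'cV[R]_r1) (g : 'cV[R]_r2) (v : R) : R :=
  mvn_pdf (Xt *m t + Xg *m g) (v *: Sigma) y.

(* In both marginal densities the flat prior on gamma is taken to be 1. *)
Definition marginal1 {R : realType} {n r1 r2 : nat} (Sigma : 'M[R]_n)
    (Xt : 'M[R]_(n, r1)) (Xg : 'M[R]_(n, r2)) (Omega : 'M[R]_r1)
    (s1 nu1 : R) (y : 'cV[R]_n) : \bar R :=
  (\int[@lebesgue_measure R]_(v in `]0%R, +oo[)
     lebint (fun g : 'cV[R]_r2 => lebint (fun t : 'cV[R]_r1 =>
       (likelihood Sigma Xt Xg y t g v
        * mvn_pdf 0 (v *: Omega) t * inv_chi2_pdf s1 nu1 v)%:E)))%E.

Definition marginal0 {R : realType} {n r1 r2 : nat} (Sigma : 'M[R]_n)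
    (Xt : 'M[R]_(n, r1)) (Xg : 'M[R]_(n, r2))
    (s0 nu0 : R) (y : 'cV[R]_n) : \bar R :=
  (\int[@lebesgue_measure R]_(v in `]0%R, +oo[)
     lebint (fun g : 'cV[R]_r2 =>
       (likelihood Sigma Xt Xg y 0 g v * inv_chi2_pdf s0 nu0 v)%:E))%E.

Definition bayes_factor {R : realType} {n r1 r2 : nat} (Sigma : 'M[R]_n)
    (Xt : 'M[R]_(n, r1)) (Xg : 'M[R]_(n, r2)) (Omega : 'M[R]_r1)
    (s0 nu0 s1 nu1 : R) (y : 'cV[R]_n) : R :=
  fine (marginal1 Sigma Xt Xg Omega s1 nu1 y)
  / fine (marginal0 Sigma Xt Xg s0 nu0 y).

Definition C1 {R : realType} {r1 : nat} (n r2 : nat) (I Omega : 'M[R]_r1)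
    (s0 nu0 s1 nu1 : R) : R :=
  kappa s1 nu1 * Gamma ((n%:R + nu1 - r2%:R) / 2)
  / (kappa s0 nu0 * Gamma ((n%:R + nu0 - r2%:R) / 2))
  * 2 `^ ((nu1 - nu0) / 2)
  * (\det (Omega + invmx I)) `^ (- (1 / 2)) * (\det I) `^ (- (1 / 2)).

Section orthogonal_model.
Context {R : realType} {n r1 r2 : nat} (Sigma : 'M[R]_n)
  (Xt : 'M[R]_(n, r1)) (Xg : 'M[R]_(n, r2)).
Hypotheses (pdSigma : posdefmx Sigma)
  (full_rank : \rank (row_mx Xt Xg) = (r1 + r2)%N)
  (orth : Xt^T *m invmx Sigma *m Xg = 0).

Let W : 'M[R]_n := invmx Sigma.

Lemma posdefmx_unit (k : nat) (A : 'M[R]_k) : posdefmx A -> A \in unitmx.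
Proof.
move=> [sA pA]; rewrite -unitmx_tr -row_free_unit -kermx_eq0.
apply/negPn/negP => /rowV0Pn[v /sub_kermxP vA v0].
have := pA v^T; rewrite -trmx0 (inj_eq trmx_inj) => /(_ v0).
by rewrite /qform trmxK -{1}sA vA mul0mx mxE ltxx.
Qed.

Lemma posdefmx_inv (k : nat) (A : 'M[R]_k) : posdefmx A -> posdefmx (invmx A).
Proof.
move=> pdA; have uA := posdefmx_unit pdA; case: pdA => sA pA.
split=> [|x x0]; first by rewrite trmx_inv sA.
have -> : qform (invmx A) x = qform A (invmx A *m x).
  by rewrite /qform trmx_mul trmx_inv sA -!mulmxA mulKVmx.
apply: pA; apply: contra x0 => /eqP h.
by rewrite -(mulKVmx uA x) h mulmx0.
Qed.

Lemma qform_ge0 (k : nat) (A : 'M[R]_k) (x : 'cV_k) : posdefmx A -> 0 <= qform A x.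
Proof.
move=> [_ pA]; have [->|/pA/ltW//] := eqVneq x 0.
by rewrite /qform mulmx0 mxE.
Qed.

Lemma mulmx_full_inj (t : 'cV_r1) (g : 'cV_r2) : Xt *m t + Xg *m g = 0 -> t = 0 /\ g = 0.
Proof.
rewrite -mul_row_col => h.
have : row_free (row_mx Xt Xg)^T by rewrite /row_free mxrank_tr full_rank.
move=> /row_freeP[B /(congr1 trmx)]; rewrite trmx_mul trmxK trmx1 => BX.
have : col_mx t g = 0 by rewrite -[col_mx t g]mul1mx -BX -mulmxA h mulmx0.
by move=> /eqP; rewrite col_mx_eq0 => /andP[/eqP ? /eqP ?].
Qed.

Lemma posdefmx_info r (X : 'M[R]_(n, r)) :
  (forall t : 'cV_r, X *m t = 0 -> t = 0) -> posdefmx (fisher_info Sigma X).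
Proof.
move=> injX; have [sW pW] := posdefmx_inv pdSigma.
split=> [|t t0]; first by rewrite /fisher_info !trmx_mul trmxK sW mulmxA.
have -> : qform (fisher_info Sigma X) t = qform W (X *m t).
  by rewrite /qform trmx_mul !mulmxA.
by apply: pW; apply: contra t0 => /eqP/injX/eqP.
Qed.

Lemma posdefmx_info_t : posdefmx (fisher_info Sigma Xt).
Proof.
by apply: posdefmx_info => t h; apply: (@mulmx_full_inj t 0 _).1; rewrite h mulmx0 addr0.
Qed.

Lemma posdefmx_info_g : posdefmx (fisher_info Sigma Xg).
Proof.
by apply: posdefmx_info => g h; apply: (@mulmx_full_inj 0 g _).2; rewrite h mulmx0 addr0.
Qed.

Lemma orth_tr : Xg^T *m W *m Xt = 0.
Proof.
have [sW _] := posdefmx_inv pdSigma.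
by apply: trmx_inj; rewrite trmx0 !trmx_mul trmxK sW mulmxA.
Qed.

Lemma qformD_orth (k : nat) (A : 'M[R]_k) (x z : 'cV_k) : A^T = A -> x^T *m A *m z = 0 ->
  qform A (x + z) = qform A x + qform A z.
Proof.
move=> sA xz; have zx : z^T *m A *m x = 0.
  by apply: trmx_inj; rewrite trmx0 !trmx_mul trmxK sA mulmxA.
rewrite /qform; have -> : (x + z)^T = x^T + z^T by rewrite linearD.
by rewrite !mulmxDl !mulmxDr xz zx addr0 add0r mxE.
Qed.

Lemma gls_mle (y : 'cV_n) (t : 'cV_r1) (g : 'cV_r2) (v : R) : 0 < v ->
  likelihood Sigma Xt Xg y t g v
  <= likelihood Sigma Xt Xg y (gls Sigma Xt y) (gls Sigma Xg y) v.
Proof.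
move=> v0; have [sW _] := posdefmx_inv pdSigma.
rewrite /likelihood /mvn_pdf ler_wpM2l ?mulr_ge0 ?powR_ge0// ler_expR lerN2.
rewrite ler_pM2r ?invr_gt0// invmxZ; last first.
  by rewrite unitmxZ ?unitfE ?gt_eqF// posdefmx_unit.
set e := y - (Xt *m gls Sigma Xt y + _).
have Xte : Xt^T *m W *m e = 0.
  rewrite /e mulmxBr mulmxDr !(mulmxA _ Xg) orth mul0mx addr0 /gls.
  rewrite !mulmxA -/W -[Xt^T *m W *m Xt]/(fisher_info Sigma Xt).
  by rewrite mulmxV ?posdefmx_unit ?mul1mx ?subrr//; exact: posdefmx_info_t.
have Xge : Xg^T *m W *m e = 0.
  rewrite /e mulmxBr mulmxDr !(mulmxA _ Xt) orth_tr mul0mx add0r /gls.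
  rewrite !mulmxA -/W -[Xg^T *m W *m Xg]/(fisher_info Sigma Xg).
  by rewrite mulmxV ?posdefmx_unit ?mul1mx ?subrr//; exact: posdefmx_info_g.
set d := Xt *m (gls Sigma Xt y - t) + Xg *m (gls Sigma Xg y - g).
have -> : y - (Xt *m t + Xg *m g) = d + e.
  rewrite /d /e !mulmxBr; move: (Xt *m gls _ _ _) (Xg *m gls _ _ _) => a b.
  by apply/matrixP => i j; rewrite !mxE; ring.
have qZ x : qform (v^-1 *: W) x = v^-1 * qform W x.
  by rewrite /qform -scalemxAr -scalemxAl mxE.
rewrite !qZ ler_pM2l ?invr_gt0// (@qformD_orth _ W d e sW).
  by rewrite -/W -/e lerDr qform_ge0//; exact: posdefmx_inv.
have -> : d^T = (gls Sigma Xt y - t)^T *m Xt^T + (gls Sigma Xg y - g)^T *m Xg^T.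
  by rewrite -!trmx_mul -linearD.
rewrite !mulmxDl -!(mulmxA _ _ W) -!(mulmxA _ _ e).
by rewrite (mulmxA _ W) Xte (mulmxA _ W) Xge !mulmx0 addr0.
Qed.

Lemma gls_add_t (t : 'cV_r1) (e : 'cV_n) : Xt^T *m W *m e = 0 ->
  gls Sigma Xt (Xt *m t + e) = t.
Proof.
move=> Xte; rewrite /gls -!mulmxA (mulmxA Xt^T) mulmxDr Xte addr0.
by rewrite (mulmxA _ Xt) mulKmx// posdefmx_unit//; exact: posdefmx_info_t.
Qed.

Lemma gls_add_g (t : 'cV_r1) (e : 'cV_n) : Xg^T *m W *m e = 0 ->
  gls Sigma Xg (Xt *m t + e) = 0.
Proof.
move=> Xge; rewrite /gls -!mulmxA (mulmxA Xg^T) mulmxDr Xge addr0.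
by rewrite (mulmxA _ Xt) orth_tr mul0mx mulmx0.
Qed.

Lemma gls_rss_surj (t : 'cV_r1) (s : R) : (r1 + r2 < n)%N -> 0 < s ->
  exists2 y, gls Sigma Xt y = t & rss Sigma Xt Xg y = s.
Proof.
move=> rn s0; have [sW pW] := posdefmx_inv pdSigma.
have : kermx (W *m row_mx Xt Xg) != 0.
  rewrite kermx_eq0 /row_free ltn_eqF//.
  by rewrite (leq_ltn_trans (mxrankM_maxr _ _))// full_rank.
move=> /rowV0Pn[v /sub_kermxP]; rewrite mul_mx_row mul_mx_row => /eqP.
rewrite row_mx_eq0 => /andP[/eqP vt /eqP vg] v0.
pose c := Num.sqrt (s / qform W v^T).
have qv : 0 < qform W v^T.
  by apply: pW; rewrite -trmx0 (inj_eq trmx_inj).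
have Xe r (X : 'M[R]_(n, r)) : v *m (W *m X) = 0 -> X^T *m W *m (c *: v^T) = 0.
  move=> h; apply: trmx_inj; rewrite trmx0 !trmx_mul sW trmxK.
  by rewrite linearZ/= trmxK -scalemxAl h scaler0.
have et := Xe _ _ vt; have eg := Xe _ _ vg.
exists (Xt *m t + c *: v^T); first exact: gls_add_t.
rewrite /rss gls_add_t// gls_add_g// mulmx0 subr0 addrAC subrr add0r.
have -> : qform W (c *: v^T) = c ^+ 2 * qform W v^T.
  rewrite /qform -scalemxAr; have -> : (c *: v^T)^T = c *: v^T^T.
    by rewrite linearZ.
  by rewrite -!scalemxAl scalerA mxE -expr2.
by rewrite sqr_sqrtr ?divfK ?gt_eqF// divr_ge0// ltW.
Qed.

End orthogonal_model.

(* The data sets with residual sum of squares s2, as the Euclidean norm of the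
   estimate of theta tends to infinity. Under the hypotheses of [gls_rss_surj]
   the estimate of theta takes every value on these data sets. *)
Definition far_data {R : realType} {n r1 r2 : nat} (Sigma : 'M[R]_n)
    (Xt : 'M[R]_(n, r1)) (Xg : 'M[R]_(n, r2)) (s2 : R) :
    set_system 'cV[R]_n :=
  filter_from [set: R] (fun M =>
    [set y | rss Sigma Xt Xg y = s2 /\ M < l2norm (gls Sigma Xt y)]).

(* Main.v *)
Require Import Defs.
From HB Require Import structures.
From mathcomp Require Import all_boot all_order all_algebra.
From mathcomp Require Import all_classical all_reals all_analysis.
From mathcomp Require Import measurable_realfun ring lra.
Set Implicit Arguments.
Unset Strict Implicit.
Import Order.TTheory GRing.Theory Num.Theory.
Import numFieldNormedType.Exports.
Local Open Scope classical_set_scope.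
Local Open Scope ring_scope.

(** The Bayes factor is a ratio of two marginal densities, and both are computed
in closed form. For orthogonal regressors the residual sum of squares at
(t, g) splits as s2 + I(t - th) + Ig(g - gh), where I and Ig are the Fisher
informations and th, gh the estimates ([residual_decomposition]). Hence the
integrals over gamma, and under H1 over theta, are Gaussian ([lebint_gauss]),
once the likelihood and the prior of theta are merged by completing a square;
what the integral over theta leaves in the exponent is the value at th of
J = (I^-1 + Omega)^-1 ([qform_complete_square]). The remaining integral over
v = sigma^2 is turned by t = c / v into a Gamma integral
([integral_inv_gamma]). The constants common to both marginals cancel, and
[bayes_factorE] is the announced formula.

With u = I(th), w = J(th) and positive constants a0, a1, p0, p1, the formula
reads C1 (a0 + u)^p0 / (a1 + w)^p1, where p0 and p1 are ordered as nu0 and nu1.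
Two positive definite forms dominate each other up to constants
([qform_dominated]), and both tend to infinity with the norm of th. So the
ratio behaves like a power of exponent p0 - p1 of either form, which gives (i)
and (ii) ([power_ratio_cvg0], [power_ratio_cvgy]).

For p0 = p1 = p, let K be the supremum of I(z) / J(z) over z != 0. Then
(a0 + u) / (a1 + w) is eventually at most K + d for each d > 0, so the upper
limit of the Bayes factor is at most C1 K^p ([power_ratio_limsup]). The
supremum is attained at some x with x^T I = K x^T J ([rayleigh_max]). As all large
multiples of x are estimates of theta from far data sets, K is the upper limit of
the ratio of the forms. Finally v I = (1 + a) v J is equivalent to
v I Omega = a v, because J^-1 = I^-1 + Omega; therefore K = 1 + lmax
([rayleigh_largest_eigenvalue]). *)

(** * Quadratic forms of positive definite matrices *)

Section linear_algebra.
Context {R : realType}.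

Lemma qformZl (k : nat) (c : R) (A : 'M[R]_k) (x : 'cV_k) :
  qform (c *: A) x = c * qform A x.
Proof. by rewrite /qform -scalemxAr -scalemxAl mxE. Qed.

Lemma qformZr (k : nat) (c : R) (A : 'M[R]_k) (x : 'cV_k) :
  qform A (c *: x) = c ^+ 2 * qform A x.
Proof.
by rewrite /qform -scalemxAr linearZ/= -!scalemxAl scalerA -expr2 mxE.
Qed.

Lemma qformDl (k : nat) (A B : 'M[R]_k) (x : 'cV_k) :
  qform (A + B) x = qform A x + qform B x.
Proof. by rewrite /qform mulmxDr mulmxDl mxE. Qed.

Lemma qform0 (k : nat) (A : 'M[R]_k) : qform A 0 = 0.
Proof. by rewrite /qform mulmx0 mxE. Qed.

Lemma bilin_sym (k : nat) (A : 'M[R]_k) (x y : 'cV_k) : A^T = A ->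
  y^T *m A *m x = x^T *m A *m y.
Proof.
move=> sA; have -> : y^T *m A *m x = (x^T *m A *m y)^T.
  by rewrite !trmx_mul trmxK sA mulmxA.
by apply/matrixP => i j; rewrite [LHS]mxE !ord1.
Qed.

Lemma qformDr (k : nat) (A : 'M[R]_k) (x y : 'cV_k) : A^T = A ->
  qform A (x + y) = qform A x + 2 * (x^T *m A *m y) ord0 ord0 + qform A y.
Proof.
move=> sA; rewrite /qform; have -> : (x + y)^T = x^T + y^T by rewrite linearD.
rewrite !mulmxDl !mulmxDr (bilin_sym x y) //.
move: (x^T *m A *m x) (x^T *m A *m y) (y^T *m A *m y) => a b c.
by rewrite !mxE; ring.
Qed.

Lemma posdefmx_sum (k : nat) (A B : 'M[R]_k) :
  posdefmx A -> posdefmx B -> posdefmx (A + B).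
Proof.
move=> [sA pA] [sB pB]; split=> [|x x0]; first by rewrite linearD/= sA sB.
by rewrite qformDl addr_gt0 ?pA ?pB.
Qed.

Lemma posdefmxZ (k : nat) (c : R) (A : 'M[R]_k) :
  0 < c -> posdefmx A -> posdefmx (c *: A).
Proof.
move=> c0 [sA pA]; split=> [|x x0]; first by rewrite linearZ/= sA.
by rewrite qformZl mulr_gt0// pA.
Qed.

Lemma posdefmx_gt0 (k : nat) (A : 'M[R]_k) (x : 'cV_k) :
  posdefmx A -> (0 < qform A x) = (x != 0).
Proof.
move=> [_ pA]; have [->|/pA//] := eqVneq x 0.
by rewrite qform0 ltxx.
Qed.

(** Splitting off the first coordinate by completing the square in the others:
D is the lower right block, and c its Schur complement, the value of the form
at (1, - w). This is the induction step for the determinant and for the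
Gaussian integral. *)
Lemma posdefmx_schur (k : nat) (A : 'M[R]_(1 + k)) : posdefmx A ->
  exists c (D : 'M[R]_k) (w : 'cV_k), [/\ 0 < c, posdefmx D, \det A = c * \det D &
    forall (x : R) (u : 'cV_k),
      qform A (col_mx x%:M u) = c * x ^+ 2 + qform D (u + x *: w)].
Proof.
move=> [sA pA]; rewrite -(submxK A).
set a := ulsubmx A; set b := ursubmx A; set b' := dlsubmx A; set D := drsubmx A.
have sD : D^T = D by rewrite /D trmx_drsub sA.
have bb' : b^T = b' by rewrite /b /b' trmx_ursub sA.
have qA (x : 'cV[R]_1) (u : 'cV[R]_k) : qform A (col_mx x u) =
    (x^T *m a *m x + x^T *m b *m u + (u^T *m b' *m x + u^T *m D *m u)) ord0 ord0.
  rewrite /qform -[in LHS](submxK A) tr_col_mx mul_row_block mul_row_col.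
  by rewrite !mulmxDl addrACA.
have pdD : posdefmx D.
  split=> // u u0; have := pA (col_mx 0 u).
  rewrite qA col_mx_eq0 eqxx/= trmx0 !mul0mx mulmx0 addr0 !add0r; exact.
have uD := posdefmx_unit pdD.
pose w := invmx D *m b'.
pose c := a ord0 ord0 - (b *m w) ord0 ord0.
have qE (x : R) (u : 'cV_k) : qform A (col_mx x%:M u) = c * x ^+ 2 + qform D (u + x *: w).
  rewrite qA qformDr// qformZr.
  have -> : qform D w = (b *m w) ord0 ord0.
    by rewrite /qform /w trmx_mul trmx_inv sD -bb' trmxK !mulmxA mulmxKV.
  have -> : (u^T *m D *m (x *: w)) = x *: (u^T *m b').
    by rewrite -scalemxAr /w -!mulmxA mulKVmx.
  have -> : x%:M^T *m b *m u = x *: (u^T *m b').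
    rewrite tr_scalar_mx mul_scalar_mx -scalemxAl; congr (_ *: _).
    have -> : b *m u = (u^T *m b')^T by rewrite trmx_mul -bb' !trmxK.
    by apply/matrixP => i j; rewrite [LHS]mxE !ord1.
  rewrite tr_scalar_mx !mul_scalar_mx !mul_mx_scalar scalerA.
  rewrite /c /qform.
  move: (u^T *m b') (u^T *m D *m u) (b *m w) => p q r.
  by rewrite !mxE; ring.
exists c, D, w; split=> //.
- have := pA (col_mx 1%:M (- w)).
  rewrite qE scale1r addNr qform0 addr0 expr1n mulr1; apply.
  rewrite col_mx_eq0 negb_and; apply/orP; left.
  by apply/eqP => /matrixP /(_ ord0 ord0); rewrite !mxE eqxx => /eqP; rewrite oner_eq0.
- have cE : c%:M = a - b *m w.
    by rewrite [RHS]mx11_scalar; congr (_%:M); rewrite /c !mxE.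
  (* Clearing the lower left block by column operations keeps the determinant. *)
  have : block_mx a b b' D *m block_mx 1%:M 0 (- w) 1%:M = block_mx c%:M b 0 D.
    rewrite mulmx_block !mulmx1 !mulmx0 !add0r cE !mulmxN /w.
    by rewrite [D *m _]mulmxA mulmxV// mul1mx subrr.
  move/(congr1 determinant).
  by rewrite det_mulmx det_lblock !det1 !mulr1 det_ublock det_scalar1.
- by move=> x u; rewrite submxK.
Qed.

Lemma det_posdefmx_gt0 (k : nat) (A : 'M[R]_k) : posdefmx A -> 0 < \det A.
Proof.
elim: k A => [|k IH] A pdA; first by rewrite det_mx00.
by have [c [D [w [c0 pdD -> _]]]] := @posdefmx_schur k A pdA; rewrite mulr_gt0 ?IH.
Qed.

Section precision.
Context {k : nat} (A B : 'M[R]_k).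
Hypotheses (pdA : posdefmx A) (pdB : posdefmx B).
Let uA := posdefmx_unit pdA.
Let uB := posdefmx_unit pdB.
Let P := A + invmx B.
Let J := invmx (invmx A + B).
Let pdP : posdefmx P.
Proof. by apply: posdefmx_sum => //; exact: posdefmx_inv. Qed.
Let pdJ' : posdefmx (invmx A + B).
Proof. by apply: posdefmx_sum => //; exact: posdefmx_inv. Qed.

(** This form of J shows that completing the square below leaves exactly J. *)
Lemma woodbury : J = A - A *m invmx P *m A.
Proof.
have uJ := posdefmx_unit pdJ'; have uP := posdefmx_unit pdP.
have E : invmx P *m (1%:M + A *m B) = B.
  have -> : 1%:M + A *m B = P *m B by rewrite mulmxDl mulVmx// addrC.
  by rewrite mulKmx.
apply: (can_inj (mulmxK uJ)); rewrite mulVmx// mulmxDr !mulmxBl mulmxV//.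
rewrite -!(mulmxA (A *m _)) mulmxV// mulmx1 addrACA -opprD -mulmxA.
have -> : A *m invmx P + A *m (invmx P *m (A *m B)) = A *m B.
  by rewrite -mulmxDr -{1}(mulmx1 (invmx P)) -mulmxDr E.
by rewrite addrK.
Qed.

(** The product of two Gaussian densities in t, with precision A around h and
covariance B around 0, is Gaussian in t with precision P = A + B^-1. The factor
free of t is Gaussian in h with the covariance A^-1 + B of the sum of two
independent errors. *)
Lemma qform_complete_square (t h : 'cV[R]_k) :
  qform A (t - h) + qform (invmx B) t
  = qform P (t - invmx P *m A *m h) + qform J h.
Proof.
have uP := posdefmx_unit pdP; have [sA _] := pdA; have [sP _] := pdP.
have Pt : qform P t = qform A t + qform (invmx B) t by rewrite qformDl.
rewrite !qformDr// Pt woodbury (qformDl A (- _)).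
have N M (x : 'cV[R]_k) : qform M (- x) = qform M x.
  by rewrite -scaleN1r qformZr expr2 mulNr mul1r opprK mul1r.
have Nl M (x : 'cV[R]_k) : qform (- M) x = - qform M x.
  by rewrite -scaleN1r qformZl mulN1r.
rewrite !N Nl.
have -> : t^T *m P *m - (invmx P *m A *m h) = t^T *m A *m - h.
  by rewrite !mulmxN -!mulmxA mulKVmx.
have -> : qform P (invmx P *m A *m h) = qform (A *m invmx P *m A) h.
  rewrite /qform !trmx_mul trmx_inv sA sP -!mulmxA.
  by rewrite (mulmxA P) mulmxV// mul1mx.
ring.
Qed.

(** Both sides are the determinant of B A + 1; this is how the determinants
produced by the Gaussian integrals become those of the Bayes factor. *)
Lemma det_precision : \det B * \det P = \det (B + invmx A) * \det A.
Proof.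
by rewrite -!det_mulmx mulmxDr mulmxDl mulmxV// mulVmx// addrC.
Qed.
End precision.
End linear_algebra.

(** * Rayleigh quotients of two definite forms *)

Section rayleigh.
Context {R : realType}.

(** The Cauchy-Schwarz inequality in the inner product of A, between x and the
vector A^-1 e_i whose inner product with x is the coordinate x_i. *)
Lemma qform_coord (k : nat) (A : 'M[R]_k) (x : 'cV_k) i : posdefmx A ->
  x i ord0 ^+ 2 <= invmx A i i * qform A x.
Proof.
move=> pdA; have uA := posdefmx_unit pdA; have [sA _] := pdA.
pose z : 'cV[R]_k := invmx A *m delta_mx i ord0.
set d := invmx A i i.
have xAz : (x^T *m A *m z) ord0 ord0 = x i ord0.
  by rewrite /z -mulmxA mulKVmx// -colE !mxE.
have zAz : qform A z = d.
  rewrite /qform {1}/z trmx_mul trmx_inv sA trmx_delta mulmxKV//.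
  by rewrite /z mulmxA -colE -rowE !mxE.
have d0 : 0 < d.
  rewrite -zAz posdefmx_gt0//; apply/negP => /eqP z0.
  have := mulKVmx uA (delta_mx i (ord0 : 'I_1)); rewrite -/z z0 mulmx0.
  by move=> /matrixP/(_ i ord0)/eqP; rewrite !mxE !eqxx/= eq_sym oner_eq0.
(* The coefficient of z minimizes the form along this line. *)
have := qform_ge0 (x + (- (x i ord0 / d)) *: z) pdA.
rewrite qformDr// qformZr zAz -scalemxAr [X in 2 * X]mxE xAz.
set q := qform A x; set a := x i ord0 => h.
have -> : d * q = a ^+ 2 + d * (q + 2 * (- (a / d) * a) + (- (a / d)) ^+ 2 * d).
  by field; rewrite gt_eqF.
by rewrite lerDl mulr_ge0// ltW.
Qed.

Lemma qform_le_sum_sqr (k : nat) (B : 'M[R]_k) (x : 'cV_k) :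
  qform B x <= (\sum_i \sum_j `|B i j|) * \sum_i x i ord0 ^+ 2.
Proof.
set S := \sum_i x i ord0 ^+ 2.
have xS i : x i ord0 ^+ 2 <= S.
  by rewrite /S (bigD1 i)//= lerDl sumr_ge0// => j _; exact: sqr_ge0.
have -> : qform B x = \sum_i \sum_j x i ord0 * B i j * x j ord0.
  rewrite /qform mxE exchange_big/=; apply: eq_bigr => j _.
  by rewrite mxE mulr_suml; apply: eq_bigr => i _; rewrite mxE.
rewrite mulr_suml ler_sum// => i _; rewrite mulr_suml ler_sum// => j _.
rewrite (le_trans (ler_norm _))// mulrAC normrM mulrC ler_wpM2l//.
rewrite ler_norml; have := xS i; have := xS j.
move: (x i ord0) (x j ord0) => a b *.
have := sqr_ge0 (a + b); have := sqr_ge0 (a - b); nra.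
Qed.

Lemma sum_sqr_le_qform (k : nat) (A : 'M[R]_k) (x : 'cV_k) : posdefmx A ->
  \sum_i x i ord0 ^+ 2 <= \tr (invmx A) * qform A x.
Proof.
by move=> pdA; rewrite /mxtrace mulr_suml ler_sum// => i _; exact: qform_coord.
Qed.

(** Both forms compare to the sum of squares of the coordinates, by
[qform_coord] for A and entrywise for B. *)
Lemma qform_dominated (k : nat) (A B : 'M[R]_k) : posdefmx A ->
  exists2 c, 0 < c & forall x, qform B x <= c * qform A x.
Proof.
move=> pdA; set b := \sum_i \sum_j `|B i j|; set t := \tr (invmx A).
have b0 : 0 <= b by rewrite !sumr_ge0// => i _; rewrite sumr_ge0.
exists (b * `|t| + 1) => [|x]; first by rewrite ltr_wpDl// mulr_ge0.
have q0 := qform_ge0 x pdA.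
rewrite (le_trans (qform_le_sum_sqr B x))// mulrDl mul1r ler_wpDr// -mulrA.
rewrite ler_wpM2l// (le_trans (sum_sqr_le_qform x pdA))// ler_wpM2r//.
exact: ler_norm.
Qed.

(** A null vector minimizes the form, so the linear term of the form at x, in any
direction z, must vanish. *)
Lemma psd_null_vector (k : nat) (M : 'M[R]_k) (x : 'cV_k) : M^T = M ->
  (forall z, 0 <= qform M z) -> qform M x = 0 -> x^T *m M = 0.
Proof.
move=> sM psd x0; apply/matrixP => i j; rewrite ord1 [RHS]mxE.
have -> : (x^T *m M) ord0 j = (x^T *m M *m delta_mx j (ord0 : 'I_1)) ord0 ord0.
  by rewrite -colE [RHS]mxE.
set z : 'cV[R]_k := delta_mx j ord0; set b := (_ *m z) ord0 ord0; set q := qform M z.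
have q0 : 0 <= q := psd z.
(* The step -b / (q + 1), rather than -b / q, also covers q = 0. *)
have /= := psd (x + (- (b / (q + 1))) *: z).
rewrite qformDr// x0 qformZr -scalemxAr [X in 2 * X]mxE -/b -/q => h.
have q1 : 0 < q + 1 by rewrite ltr_wpDl.
have E : 0 + 2 * (- (b / (q + 1)) * b) + (- (b / (q + 1))) ^+ 2 * q
    = - ((b / (q + 1)) ^+ 2 * (q + 2)) by field; rewrite gt_eqF.
move: h; rewrite E oppr_ge0 pmulr_lle0 ?ltr_wpDl// => h.
have : (b / (q + 1)) ^+ 2 == 0 by rewrite eq_le h sqr_ge0.
by rewrite sqrf_eq0 mulf_eq0 invr_eq0 (gt_eqF q1) orbF => /eqP.
Qed.

(** The supremum K of A(z) / J(z) is attained. Otherwise K J - A would be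
positive definite, hence at least J / e for some e > 0, and K - 1 / e would
already bound the ratio. A vector where K J - A vanishes is then in its
kernel. *)
Lemma rayleigh_max (k : nat) (A J : 'M[R]_k) : (0 < k)%N ->
  posdefmx A -> posdefmx J ->
  exists K (x : 'cV_k), [/\ x != 0, x^T *m A = K *: (x^T *m J) &
    forall z, qform A z <= K * qform J z].
Proof.
move=> k0 pdA pdJ; have [sA _] := pdA; have [sJ _] := pdJ.
pose E := [set qform A z / qform J z | z in [set z : 'cV[R]_k | z != 0]].
have [c c0 AJ] := qform_dominated A pdJ.
have E0 : E !=set0.
  exists (qform A (const_mx 1) / qform J (const_mx 1)), (const_mx 1) => //=.
  apply/eqP => /matrixP/(_ (Ordinal k0) ord0)/eqP.
  by rewrite !mxE oner_eq0.
have Eub : has_ubound E.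
  by exists c => _ [z z0 <-]; rewrite ler_pdivrMr// posdefmx_gt0.
pose K := sup E.
have AK z : qform A z <= K * qform J z.
  have [->|z0] := eqVneq z 0; first by rewrite !qform0 mulr0.
  rewrite -ler_pdivrMr ?posdefmx_gt0//.
  by apply: ub_le_sup => //; exists z.
pose M := K *: J + (- 1) *: A.
have qM z : qform M z = K * qform J z - qform A z.
  by rewrite qformDl !qformZl mulN1r.
have sM : M^T = M by rewrite linearD/= !linearZ/= sA sJ.
have psdM z : 0 <= qform M z by rewrite qM subr_ge0.
have [x [x0 Mx]] : exists x, x != 0 /\ qform M x = 0.
  apply: contrapT => /forallNP nM.
  have pdM : posdefmx M.
    split=> // x x0; rewrite lt_neqAle psdM andbT eq_sym.
    by apply/negP => /eqP Mx; exact: (nM x).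
  have [e e0 JM] := qform_dominated J pdM.
  have : K <= K - e^-1.
    apply: ge_sup => // _ [z z0 <-]; rewrite ler_pdivrMr ?posdefmx_gt0//.
    have h : e^-1 * qform J z <= K * qform J z - qform A z.
      by rewrite ler_pdivrMl// -qM.
    by rewrite mulrBl; lra.
  by rewrite lerBrDr gerDl leNgt invr_gt0 e0.
exists K, x; split=> //.
have := psd_null_vector sM psdM Mx.
rewrite mulmxDr -!scalemxAr scaleN1r => /eqP.
by rewrite subr_eq0 => /eqP.
Qed.

(** A generalized eigenvector, v A = (1 + a) v J, is an eigenvector of A B for
the eigenvalue a, because J^-1 = A^-1 + B. The maximizer of the ratio thus
yields an eigenvalue, and no eigenvector can exceed the maximum. *)
Lemma rayleigh_largest_eigenvalue (k : nat) (A B : 'M[R]_k) : (0 < k)%N ->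
  posdefmx A -> posdefmx B -> let J := invmx (invmx A + B) in
  exists l (x : 'cV_k), [/\ largest_eigenvalue (A *m B) l, x != 0,
    qform A x = (1 + l) * qform J x &
    forall z, qform A z <= (1 + l) * qform J z].
Proof.
move=> k0 pdA pdB J; have uA := posdefmx_unit pdA.
have pdJ' : posdefmx (invmx A + B).
  by apply: posdefmx_sum => //; exact: posdefmx_inv.
have uJ' := posdefmx_unit pdJ'.
have pdJ : posdefmx J := posdefmx_inv pdJ'.
have eigE (v : 'rV_k) a : v *m (A *m B) = a *: v <-> v *m A = (1 + a) *: (v *m J).
  have AJ' : v *m A *m (invmx A + B) = v + v *m (A *m B).
    by rewrite mulmxDr mulmxK// mulmxA.
  split=> [h|h].
    by rewrite -[LHS](mulmxK uJ') AJ' h -{1}[v]scale1r -scalerDl scalemxAl.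
  apply/(addrI v); rewrite -AJ' h -scalemxAl mulmxKV//.
  by rewrite scalerDl scale1r.
have [K [x [x0 AxJ AK]]] := rayleigh_max k0 pdA pdJ.
exists (K - 1), x; rewrite [1 + _]addrC subrK; split=> //; last first.
  by rewrite /qform AxJ -scalemxAl mxE.
split.
  apply/eigenvalueP; exists x^T; last by rewrite -trmx0 (inj_eq trmx_inj).
  by apply/eigE; rewrite [1 + _]addrC subrK.
move=> a /eigenvalueP[v /eigE va v0]; rewrite lerBrDl.
have vt0 : v^T != 0 by rewrite -trmx0 (inj_eq trmx_inj).
have := AK v^T; rewrite {1}/qform trmxK va -scalemxAl mxE.
by rewrite -{1}[v]trmxK -/(qform J _) ler_pM2r// posdefmx_gt0.
Qed.
End rayleigh.

(** * Gaussian integrals *)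

Section gaussian.
Context {R : realType}.
Notation mu := (@lebesgue_measure R).

Lemma integral_gauss_quadratic (C c m : R) : 0 <= C -> 0 < c ->
  (\int[mu]_x (C * expR (- (c * (x - m) ^+ 2 / 2)))%:E)%E
  = (C * ((2 * pi) `^ (1 / 2) * c `^ (- (1 / 2))))%:E.
Proof.
move=> C0 c0; set s := Num.sqrt c^-1.
have s0 : s != 0 by rewrite gt_eqF// sqrtr_gt0 invr_gt0.
have s2 : s ^+ 2 = c^-1 by rewrite sqr_sqrtr// invr_ge0 ltW.
have pE : (normal_peak s)^-1 = (2 * pi) `^ (1 / 2) * c `^ (- (1 / 2)).
  rewrite /normal_peak invrK s2 powRN div1r powR12_sqrt ?mulr_ge0 ?pi_ge0//.
  rewrite powR12_sqrt ?ltW// -sqrtrV ?ltW// -sqrtrM ?mulr_ge0 ?pi_ge0//.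
  by congr Num.sqrt; rewrite -mulr_natl; ring.
have p0 := normal_peak_gt0 s0.
transitivity (\int[mu]_x ((C * (normal_peak s)^-1)%:E * (normal_pdf m s x)%:E))%E.
  apply: eq_integral => x _; rewrite -EFinM normal_pdfE//= -[C / _ * _]mulrA mulKf ?gt_eqF//.
  rewrite /normal_fun s2; congr (_ * expR _)%:E.
  by rewrite -mulr_natl; field; rewrite gt_eqF.
rewrite ge0_integralZl_EFin//.
- by rewrite integral_normal_pdf mule1 pE.
- by move=> x _; rewrite lee_fin normal_pdf_ge0.
- by apply/measurable_EFinP; exact: measurable_normal_pdf.
- by rewrite mulr_ge0// invr_ge0 ltW.
Qed.

(** Induction on the dimension: after [posdefmx_schur] the integral over all
coordinates but the first is Gaussian with a centre that depends on the first
coordinate x, but its value does not depend on the centre. *)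
Lemma lebint_gauss (k : nat) (A : 'M[R]_k) (m : 'cV_k) (C : R) :
  posdefmx A -> 0 <= C ->
  lebint (fun x => (C * expR (- (qform A (x - m) / 2)))%:E)
  = (C * ((2 * pi) `^ (k%:R / 2) * (\det A) `^ (- (1 / 2))))%:E.
Proof.
elim: k A m C => [|k IH] A m C pdA C0.
  rewrite /= det_mx00 powR1 mul0r powRr0 !mulr1.
  by rewrite /qform mxE big_ord0 mul0r oppr0 expR0 mulr1.
have [c [D [w [c0 pdD detA qA]]]] := @posdefmx_schur R k A pdA.
rewrite /=.
pose m0 := m ord0 ord0; pose m1 : 'cV[R]_k := @dsubmx _ 1 k 1 m.
have mE : m = col_mx (m0%:M : 'cV_1) m1.
  suff -> : m0%:M = @usubmx _ 1 k 1 m by rewrite vsubmxK.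
  rewrite [RHS]mx11_scalar; congr (_%:M).
  by rewrite !mxE; congr (m _ _); apply/val_inj.
transitivity (\int[mu]_x ((C * ((2 * pi) `^ (k%:R / 2) * (\det D) `^ (- (1 / 2)))) *
    expR (- (c * (x - m0) ^+ 2 / 2)))%:E)%E.
  apply: eq_integral => x _.
  rewrite mulrAC -(IH D (m1 - (x - m0) *: w)) ?mulr_ge0 ?expR_ge0//.
  congr lebint; apply/funext => u; congr _%:E.
  rewrite -[RHS]mulrA -expRD; congr (_ * expR _).
  have -> : col_mx x%:M u - m = col_mx (x - m0)%:M (u - m1).
    rewrite mE; transitivity (col_mx (x%:M - m0%:M : 'cV[R]_1) (u - m1)).
      by rewrite -add_col_mx -opp_col_mx.
    by rewrite -raddfB.
  by rewrite qA opprB addrA addrAC; ring.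
have D0 : 0 <= C * ((2 * pi) `^ (k%:R / 2) * (\det D) `^ (- (1 / 2))).
  by rewrite !mulr_ge0 ?powR_ge0.
rewrite integral_gauss_quadratic// detA (powRM _ (ltW c0) (ltW (det_posdefmx_gt0 pdD))).
have -> : (k.+1%:R / 2 : R) = k%:R / 2 + 1 / 2 by rewrite -natr1 mulrDl.
rewrite [(2 * pi) `^ (_ + _)]powRD; last by rewrite gt_eqF ?implybT// mulr_gt0 ?pi_gt0.
by congr _%:E; ring.
Qed.
End gaussian.

(** * The Gamma function and its inverse-argument integral *)

Section gamma.
Context {R : realType}.
Notation mu := (@lebesgue_measure R).

Definition gamma_kernel (a t : R) := t `^ (a - 1) * expR (- t).

Lemma powRDgt0 (x r s : R) : 0 < x -> x `^ (r + s) = x `^ r * x `^ s.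
Proof. by move=> x0; rewrite powRD// lt0r_neq0 ?implybT. Qed.

Lemma powR_continuous_at (a x : R) : 0 < x -> {for x, continuous (fun t : R => t `^ a)}.
Proof.
move=> x0; apply/differentiable_continuous/derivable1_diffP.
by apply: derivable_powR; rewrite in_itv/= andbT.
Qed.

Lemma gamma_kernel_continuous_at (a x : R) : 0 < x -> {for x, continuous (gamma_kernel a)}.
Proof.
move=> x0; apply: continuousM; first exact: powR_continuous_at.
apply: continuous_comp; first exact: opp_continuous.
exact: continuous_expR.
Qed.

Lemma measurable_gamma_kernel (a : R) : measurable_fun setT (gamma_kernel a).
Proof.
apply: measurable_funM; first exact: measurable_powR.
by apply: measurableT_comp; [exact: measurable_expR|exact: oppr_measurable].
Qed.

Lemma bigcup_itv_dilate (c : R) : 0 < c ->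
  \bigcup_k `[c / k.+1%:R, c * k.+1%:R]%classic = `]0, +oo[%classic.
Proof.
move=> c0; apply/seteqP; split=> [x [k _]/=|x /=]; rewrite !in_itv/= ?andbT.
  by move=> /andP[+ _]; apply: lt_le_trans; rewrite divr_gt0.
move=> x0; pose k := Num.Def.archi_bound (x / c + c / x).
have k_gt : x / c + c / x < k.+1%:R.
  rewrite (@lt_trans _ _ k%:R) ?ltr_nat//.
  by rewrite archi_boundP// addr_ge0// divr_ge0// ltW.
exists k => //=; rewrite in_itv/=; apply/andP; split.
  rewrite ler_pdivrMr// mulrC -ler_pdivrMr// ltW//.
  by rewrite (le_lt_trans _ k_gt)// lerDr divr_ge0// ltW.
rewrite mulrC -ler_pdivrMr// ltW//.
by rewrite (le_lt_trans _ k_gt)// lerDl divr_ge0// ltW.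
Qed.

(** Exhausting the half-line by these intervals suits the substitution t = c / v,
which maps the k-th interval for c = 1 onto the k-th interval for c. *)
Lemma cvg_integral_dilate (c : R) (f : R -> R) : 0 < c ->
  measurable_fun `](0 : R), +oo[ f -> (forall x, 0 < x -> 0 <= f x) ->
  (\int[mu]_(x in `[(c / k.+1%:R)%R, (c * k.+1%:R)%R]) (f x)%:E @[k --> \oo]
   --> \int[mu]_(x in `]0%R, +oo[) (f x)%:E)%E.
Proof.
move=> c0 mf f0; rewrite -(bigcup_itv_dilate c0).
apply: ge0_nondecreasing_set_cvg_integral => //.
- apply/nondecreasing_seqP => k; apply/subsetPset => x /=; rewrite !in_itv/=.
  move=> /andP[kx xk]; apply/andP; split.
    by apply: le_trans kx; rewrite ler_pM2l// lef_pV2 ?posrE// ler_nat.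
  by apply: le_trans xk _; rewrite ler_pM2l// ler_nat.
- move=> k; apply/measurable_EFinP; apply: measurable_funS mf => //.
  by rewrite -(bigcup_itv_dilate c0) => x kx; exists k.
- move=> k x /=; rewrite in_itv/= => /andP[kx _].
  by rewrite lee_fin f0// (lt_le_trans _ kx)// divr_gt0.
Qed.

Lemma is_derive_divr (c x : R) : x != 0 ->
  is_derive x (1 : R) (fun v : R => c / v) (- (c / x ^+ 2)).
Proof.
move=> x0; have dV : is_derive x (1 : R) (fun v : R => v^-1) (- x ^- 2 *: (1:R)).
  exact: (@is_deriveV _ id).
have -> : (fun v : R => c / v) = c \*: (fun v : R => v^-1) by [].
apply: is_derive_eq; rewrite /GRing.scale/= mulr1 mulrN //.
Qed.

Lemma gamma_substitution (a c x y : R) : 0 < c -> 0 < x -> x <= y ->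
  (\int[mu]_(t in `[(c / y)%R, (c / x)%R]) (gamma_kernel a t)%:E
   = \int[mu]_(v in `[x, y]) (c `^ a * (v `^ (- a - 1) * expR (- (c / v))))%:E)%E.
Proof.
move=> c0 x0 xy; pose F v := c / v.
have gt0 v : v \in `[x, y] -> 0 < v.
  by rewrite in_itv/= => /andP[xv _]; exact: lt_le_trans xv.
have dF (v : R) : 0 < v -> is_derive v (1 : R) F (- (c / v ^+ 2)).
  by move=> v0; apply: is_derive_divr; rewrite gt_eqF.
have F'E (v : R) : 0 < v -> F^`()%classic v = - (c / v ^+ 2).
  by move=> v0; have ? := dF _ v0; rewrite derive1E derive_val.
have cF (v : R) : 0 < v -> {for v, continuous F}.
  move=> v0; apply/differentiable_continuous/derivable1_diffP.
  by have ? := dF _ v0; exact: ex_derive.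
have cF' (v : R) : 0 < v -> {for v, continuous F^`()%classic}.
  move=> v0; rewrite /prop_for /continuous_at F'E//.
  have : - (c / u ^+ 2) @[u --> v] --> - (c / v ^+ 2).
    apply: cvgN; apply: cvgM; first exact: cvg_cst.
    apply: cvgV; first by rewrite gt_eqF// exprn_gt0.
    exact: exprn_continuous.
  apply: cvg_trans; apply: near_eq_cvg.
  by near=> u; rewrite F'E//; near: u; exact: lt_nbhsr.
rewrite (@integration_by_substitution_decreasing _ F (gamma_kernel a) x y).
- apply: eq_integral => v; rewrite inE/= => /gt0 v0; congr _%:E.
  transitivity (gamma_kernel a (F v) * - F^`()%classic v); first by [].
  rewrite F'E// opprK /gamma_kernel /F powRM ?invr_ge0 ?(ltW c0) ?(ltW v0)//.
  have -> : v^-1 = v `^ (-1) by rewrite powR_inv1 ?ltW.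
  have -> : v ^+ 2 = v `^ 2 by rewrite powR_mulrn ?ltW.
  rewrite -powRN -powRrM.
  have -> : c `^ a = c `^ (a - 1) * c.
    by rewrite -[X in _ = _ * X](powRr1 (ltW c0)) -powRDgt0// subrK.
  have -> : v `^ (- a - 1) = v `^ (- 1 * (a - 1)) * v `^ (- 2).
    by rewrite -powRDgt0//; congr powR; ring.
  ring.
- by [].
- move=> u v /gt0 u0 /gt0 v0 uv; rewrite /F ltr_pM2l// ltf_pV2 ?posrE//.
- move=> v vxy; apply: cF'; apply: gt0; move: vxy.
  by apply: subset_itvW.
- apply/cvg_ex; exists (F^`()%classic x); apply: cvg_at_right_filter.
  exact: cF'.
- apply/cvg_ex; exists (F^`()%classic y); apply: cvg_at_left_filter.
  by apply: cF'; exact: lt_le_trans xy.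
- split.
  + move=> v vxy; have v0 : 0 < v by apply: gt0; move: vxy; exact: subset_itvW.
    by have ? := dF _ v0; exact: ex_derive.
  + by apply: cvg_at_right_filter; exact: cF.
  + by apply: cvg_at_left_filter; apply: cF; exact: lt_le_trans xy.
- apply: continuous_in_subspaceT => t; rewrite inE/= in_itv/= => /andP[t0 _].
  apply: gamma_kernel_continuous_at; apply: lt_le_trans t0.
  by rewrite divr_gt0// (lt_le_trans x0).
Unshelve. all: by end_near. Qed.

Lemma integral_inv_gamma (a c : R) : 0 < c ->
  (\int[mu]_(v in `]0%R, +oo[) (v `^ (- a - 1) * expR (- (c / v)))%:E
   = (c `^ (- a))%:E * \int[mu]_(t in `]0%R, +oo[) (gamma_kernel a t)%:E)%E.
Proof.
move=> c0; set g := fun v : R => v `^ (- a - 1) * expR (- (c / v)).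
have mg : measurable_fun `](0 : R), +oo[ g.
  apply: open_continuous_measurable_fun => // v; rewrite inE/= in_itv/= andbT => v0.
  apply: cvgM; first exact: powR_continuous_at.
  apply: (cvg_comp (fun v : R => - (c / v)) expR); last exact: continuous_expR.
  apply: cvgN; apply: cvgM; first exact: cvg_cst.
  by apply: inv_continuous; rewrite gt_eqF.
have g0 v : 0 <= g v by rewrite mulr_ge0 ?powR_ge0 ?expR_ge0.
have h0 v : 0 <= gamma_kernel a v by rewrite mulr_ge0 ?powR_ge0 ?expR_ge0.
have mcg : measurable_fun `](0 : R), +oo[ (fun v => c `^ a * g v).
  exact: measurable_funM.
have hE : (\int[mu]_(t in `]0%R, +oo[) (gamma_kernel a t)%:E =
    \int[mu]_(v in `]0%R, +oo[) (c `^ a * g v)%:E)%E.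
  have lim_h := cvg_integral_dilate c0 (measurable_funTS (measurable_gamma_kernel a))
    (fun x _ => h0 x).
  have lim_g := cvg_integral_dilate ltr01 mcg (fun x _ => mulr_ge0 (powR_ge0 c a) (g0 x)).
  apply: (@cvg_unique _ (@ereal_hausdorff R) _ _ _ _ lim_h).
  move: lim_g; apply: cvg_trans; apply: near_eq_cvg; near=> k.
  have k0 : (0 : R) < k.+1%:R by [].
  rewrite div1r mul1r -gamma_substitution ?invr_gt0//.
    by rewrite invrK.
  by rewrite (@le_trans _ _ 1) ?invf_le1 ?ler1n.
rewrite hE -[RHS]ge0_integralZl_EFin ?powR_ge0//.
- by apply: eq_integral => v _; rewrite -EFinM mulrA -powRDgt0// addNr powRr0 mul1r.
- by move=> v _; rewrite lee_fin mulr_ge0 ?powR_ge0.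
- exact/measurable_EFinP.
Unshelve. all: by end_near. Qed.

(** This is ln x <= x - 1 at x = (1 + t) / p. *)
Lemma exp_dominates_powR (p t : R) : 0 < p -> 0 <= t ->
  (1 + t) `^ p <= p `^ p * expR (t + 1 - p).
Proof.
move=> p0 t0; have t1 : 0 < 1 + t by rewrite ltr_wpDr.
rewrite /powR !gt_eqF// -expRD ler_expR -ler_pdivlMl//.
have -> : p^-1 * (p * ln p + (t + 1 - p)) = ln p + ((1 + t) / p - 1).
  by field; rewrite gt_eqF.
rewrite -lerBlDl -ln_div ?posrE//.
rewrite -{1}[(1 + t) / p](subrKC 1) le_ln1Dx//.
by rewrite ltrBrDl subrr divr_gt0.
Qed.

(** For a, k > 0 the primitive is k (u / (1 + u))^a, which stays in [0, k], while its
derivative is a multiple of u^(a - 1) (1 + u)^(- a - 1). It controls the Gamma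
integrand both at 0 and at infinity. *)
Lemma is_derive_gamma_majorant (a k t : R) : 0 < t ->
  is_derive t (1 : R) (fun u : R => k * expR (a * (ln u - ln (1 + u))))
    (k * a * (t `^ (a - 1) * (1 + t) `^ (- a - 1))).
Proof.
move=> t0; have t1 : 0 < 1 + t by rewrite addr_gt0.
have d1 := is_derive1_ln t0.
have d2 : is_derive t (1 : R) (fun u : R => ln (1 + u)) (1 + t)^-1.
  have dl := is_derive1_ln t1.
  have ds : is_derive t (1 : R) (fun u : R => 1 + u) 1.
    have -> : (fun u : R => 1 + u) = cst (1 : R) + id by [].
    by apply: is_derive_eq; rewrite add0r.
  rewrite -[X in is_derive _ _ _ X]mulr1.
  exact: (@is_derive1_comp _ (@ln R) (fun u => 1 + u)).
have d3 : is_derive t (1 : R) (fun u : R => a * (ln u - ln (1 + u)))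
    (a * (t^-1 - (1 + t)^-1)).
  have -> : (fun u : R => a * (ln u - ln (1 + u)))
    = a \*: ((@ln R) - (fun u => ln (1 + u))) by [].
  by apply: is_derive_eq; rewrite /GRing.scale.
have d4 := @is_derive1_comp R expR (fun u : R => a * (ln u - ln (1 + u))) t _ _
  (is_derive_expR _) d3.
have -> : (fun u : R => k * expR (a * (ln u - ln (1 + u))))
    = k \*: (expR \o (fun u : R => a * (ln u - ln (1 + u)))) by [].
apply: is_derive_eq; rewrite /GRing.scale/=.
have -> : expR (a * (ln t - ln (1 + t))) = t `^ a * (1 + t) `^ (- a).
  by rewrite /powR !gt_eqF// -expRD; congr expR; ring.
rewrite !powRDgt0// !powR_inv1 ?ltW//.
by field; rewrite !gt_eqF.
Qed.

Lemma gamma_integral_le (a x y : R) : 0 < a -> 0 < x -> x < y ->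
  (\int[mu]_(t in `[x, y]) (gamma_kernel a t)%:E <= ((a + 1) `^ (a + 1) / a)%:E)%E.
Proof.
move=> a0 x0 xy; have a1 : 0 < a + 1 by rewrite addr_gt0.
have gt0 (v : R) : v \in `[x, y] -> 0 < v.
  by rewrite in_itv/= => /andP[xv _]; exact: lt_le_trans xv.
set k := (a + 1) `^ (a + 1) / a; have k0 : 0 <= k by rewrite divr_ge0 ?powR_ge0// ltW.
pose F u := k * expR (a * (ln u - ln (1 + u))).
pose f t : R := k * a * (t `^ (a - 1) * (1 + t) `^ (- a - 1)).
have dF (t : R) : 0 < t -> is_derive t (1 : R) F (f t).
  exact: is_derive_gamma_majorant.
have cF (t : R) : 0 < t -> {for t, continuous F}.
  move=> t0; apply/differentiable_continuous/derivable1_diffP.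
  by have ? := dF _ t0; exact: ex_derive.
have y0 : 0 < y by exact: lt_trans xy.
(* The constant k makes the derivative f dominate the Gamma integrand. *)
have intf : (\int[mu]_(t in `[x, y]) (f t)%:E = (F y)%:E - (F x)%:E)%E.
  apply: continuous_FTC2 => //.
  - apply: continuous_in_subspaceT => t; rewrite inE/= => /gt0 t0.
    apply: cvgM; first exact: cvg_cst.
    apply: cvgM; first exact: powR_continuous_at.
    apply: (cvg_comp (fun t : R => 1 + t) (fun u : R => u `^ (- a - 1))).
      by apply: cvgD; [exact: cvg_cst|exact: cvg_id].
    by apply: powR_continuous_at; rewrite addr_gt0.
  - split.
    + move=> t txy; have t0 : 0 < t by apply: gt0; move: txy; exact: subset_itvW.
      by have ? := dF _ t0; exact: ex_derive.
    + by apply: cvg_at_right_filter; exact: cF.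
    + by apply: cvg_at_left_filter; exact: cF.
  - move=> t txy; have t0 : 0 < t by apply: gt0; move: txy; exact: subset_itvW.
    by have ? := dF _ t0; rewrite derive1E derive_val.
apply: (@le_trans _ _ (\int[mu]_(t in `[x, y]) (f t)%:E)%E).
  apply: ge0_le_integral => //.
  - by move=> t _; rewrite lee_fin mulr_ge0 ?powR_ge0 ?expR_ge0.
  - by apply/measurable_EFinP; apply: measurable_funTS; exact: measurable_gamma_kernel.
  - apply/measurable_EFinP; apply: measurable_funTS.
    apply: measurable_funM => //; apply: measurable_funM; first exact: measurable_powR.
    apply: (measurableT_comp (measurable_powR _)).
    exact: measurable_funD.
  - move=> t /gt0 t0; rewrite lee_fin /f mulrCA ler_wpM2l ?powR_ge0//.
    rewrite /k divfK ?gt_eqF// -[- a - 1]opprD powRN expRN.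
    have t1 : 0 < 1 + t by rewrite addr_gt0.
    rewrite ler_pdivlMr ?powR_gt0// ler_pdivrMl ?expR_gt0// mulrC.
    rewrite (le_trans (exp_dominates_powR a1 (ltW t0)))// ler_wpM2l ?powR_ge0//.
    by rewrite ler_expR opprD; lra.
rewrite intf -EFinB lee_fin lerBlDr ler_wpDr//; first by rewrite mulr_ge0 ?expR_ge0.
rewrite /F ler_piMr// -expR0 ler_expR pmulr_rle0// subr_le0.
by rewrite ler_ln ?posrE ?addr_gt0// lerDr.
Qed.

(** The definition of Gamma takes the finite part of the integral; the uniform
bound on compact intervals shows that nothing is lost. *)
Lemma integral_gamma (a : R) : 0 < a ->
  (\int[mu]_(t in `]0%R, +oo[) (gamma_kernel a t)%:E = (Gamma a)%:E)%E.
Proof.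
move=> a0; have h0 v : 0 <= gamma_kernel a v by rewrite mulr_ge0 ?powR_ge0 ?expR_ge0.
rewrite /Gamma /Rintegral fineK// ge0_fin_numE; last first.
  by apply: integral_ge0 => t _; rewrite lee_fin; exact: h0.
have lim_h := cvg_integral_dilate ltr01 (measurable_funTS (measurable_gamma_kernel a))
    (fun x _ => h0 x).
have hle : (\int[mu]_(t in `]0%R, +oo[) (gamma_kernel a t)%:E <= ((a + 1) `^ (a + 1) / a)%:E)%E.
  rewrite -(cvg_lim _ lim_h)//; apply: lime_le; first by apply/cvg_ex; eexists; exact: lim_h.
  near=> k; apply: gamma_integral_le => //.
  have k0 : (0 < k)%N by near: k; exact: nbhs_infty_gt.
  by rewrite !mul1r (@lt_trans _ _ 1) ?invf_lt1 ?ltr1n ?ltnS.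
by rewrite (le_lt_trans hle)// ltry.
Unshelve. all: by end_near. Qed.

Lemma Gamma_gt0 (a : R) : 0 < a -> 0 < Gamma a.
Proof.
move=> a0; rewrite -lte_fin -integral_gamma//.
have h0 v : 0 <= gamma_kernel a v by rewrite mulr_ge0 ?powR_ge0 ?expR_ge0.
have mh : measurable_fun `](0 : R), +oo[ (EFin \o gamma_kernel a).
  by apply/measurable_EFinP; apply: measurable_funTS; exact: measurable_gamma_kernel.
(* A lower bound of the integrand on [1, 2], from |(a - 1) ln t| <= 2 |a - 1|. *)
pose c := expR (- (`|a - 1| + 1) * 2).
apply: (@lt_le_trans _ _ (\int[mu]_(t in `[1%R, 2%R]) (cst c%:E t))%E).
  rewrite integral_cst//= lebesgue_measure_itv/= lte_fin ltr1n.
  by rewrite -EFinB -EFinM lte_fin mulr_gt0 ?expR_gt0// subr_gt0 ltr1n.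
apply: (@le_trans _ _ (\int[mu]_(t in `[1%R, 2%R]) (gamma_kernel a t)%:E)%E); last first.
  apply: ge0_subset_integral => //; first by move=> t _; rewrite lee_fin.
  by move=> t/=; rewrite !in_itv/= andbT => /andP[t1 _]; exact: lt_le_trans t1.
apply: ge0_le_integral => //.
- by move=> t _; rewrite lee_fin expR_ge0.
- by apply/measurable_EFinP; apply: measurable_funTS; exact: measurable_gamma_kernel.
move=> t /=; rewrite in_itv/= => /andP[t1 t2]; have t0 : 0 < t by exact: lt_le_trans t1.
rewrite lee_fin /c /gamma_kernel /powR gt_eqF// -expRD ler_expR.
have lnt : ln t <= 2.
  rewrite -{1}[t](subrKC 1) (le_trans (le_ln1Dx _))//; last by lra.
  by rewrite ltrBrDl subrr.
have lnt0 : 0 <= ln t by rewrite ln_ge0.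
have := ler_norm (- (a - 1)); rewrite normrN => an.
have : `|a - 1| * ln t <= `|a - 1| * 2 by rewrite ler_wpM2l.
have : - (a - 1) * ln t <= `|a - 1| * ln t by rewrite ler_wpM2r.
rewrite mulrDl; move: (`|a - 1|) (ln t) => b l *; nra.
Qed.
End gamma.

(** * Marginal densities *)

Section marginals.
Context {R : realType}.
Notation mu := (@lebesgue_measure R).

Lemma expRN_divD (x y z : R) :
  expR (- ((x + y) / z)) = expR (- (x / z)) * expR (- (y / z)).
Proof. by rewrite mulrDl opprD expRD. Qed.

Lemma kappa_gt0 (s nu : R) : 0 < s -> 0 < kappa s nu.
Proof.
move=> s0; rewrite /kappa; case: ifPn => // nu0.
by rewrite divr_gt0 ?Gamma_gt0 ?mulr_gt0 ?powR_gt0 ?divr_gt0.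
Qed.

Lemma det_scaled_powR (k : nat) (V : 'M[R]_k) (v : R) : posdefmx V -> 0 < v ->
  (\det (v *: V)) `^ (- (1 / 2)) = v `^ (- (k%:R / 2)) * (\det V) `^ (- (1 / 2)).
Proof.
move=> pdV v0; have dV := det_posdefmx_gt0 pdV.
rewrite detZ powRM ?exprn_ge0 ?ltW// -powR_mulrn ?ltW// -powRrM.
by congr (powR _ _ * _); field.
Qed.

Lemma lebint_gauss_scaled (k : nat) (A : 'M[R]_k) (m : 'cV_k) (C v : R) :
  posdefmx A -> 0 < v -> 0 <= C ->
  lebint (fun x => (C * expR (- (qform A (x - m) / (2 * v))))%:E)
  = (C * ((2 * pi) `^ (k%:R / 2) * v `^ (k%:R / 2) * (\det A) `^ (- (1 / 2))))%:E.
Proof.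
move=> pdA v0 C0.
have pdvA : posdefmx (v^-1 *: A) by apply: posdefmxZ; rewrite ?invr_gt0.
transitivity (lebint (fun x => (C * expR (- (qform (v^-1 *: A) (x - m) / 2)))%:E)).
  congr lebint; apply/funext => x; rewrite qformZl; congr (_ * expR _)%:E.
  by field; rewrite gt_eqF.
rewrite lebint_gauss// det_scaled_powR ?invr_gt0//.
rewrite -[v^-1]powR_inv1 ?ltW// -powRrM mulN1r opprK.
by rewrite !mulrA.
Qed.

Lemma mvn_pdf_scaled (k : nat) (V : 'M[R]_k) (m x : 'cV_k) (v : R) :
  posdefmx V -> 0 < v ->
  mvn_pdf m (v *: V) x =
  (2 * pi) `^ (- (k%:R / 2)) * (v `^ (- (k%:R / 2)) * (\det V) `^ (- (1 / 2)))
  * expR (- (qform (invmx V) (x - m) / (2 * v))).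
Proof.
move=> pdV v0; rewrite /mvn_pdf det_scaled_powR//.
congr (_ * expR _); rewrite invmxZ ?unitmxZ ?unitfE ?gt_eqF ?posdefmx_unit//.
by rewrite qformZl; field; rewrite gt_eqF.
Qed.

Lemma integral_inv_chi2 (K b s nu Q : R) : 0 <= K -> 0 < s -> 0 <= nu -> 0 < Q ->
  0 < b + nu / 2 ->
  (\int[mu]_(v in `]0%R, +oo[)
     (K * v `^ (- b) * expR (- (Q / (2 * v))) * inv_chi2_pdf s nu v)%:E
   = (K * kappa s nu * ((s ^+ 2 * nu + Q) / 2) `^ (- (b + nu / 2))
      * Gamma (b + nu / 2))%:E)%E.
Proof.
move=> K0 s0 nu0 Q0 bnu; have k0 := kappa_gt0 nu s0.
set a := b + nu / 2; set c := (s ^+ 2 * nu + Q) / 2.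
have c0 : 0 < c by rewrite divr_gt0// ltr_wpDl// mulr_ge0// sqr_ge0.
transitivity (\int[mu]_(v in `]0%R, +oo[)
    ((K * kappa s nu)%:E * (v `^ (- a - 1) * expR (- (c / v)))%:E))%E.
  apply: eq_integral => v; rewrite inE/= in_itv/= andbT => v0.
  rewrite -EFinM; congr _%:E; rewrite /inv_chi2_pdf.
  have -> : - (c / v) = - (Q / (2 * v)) - nu * s ^+ 2 / (2 * v).
    by rewrite /c; field; rewrite gt_eqF.
  have -> : - a - 1 = - b + (- (nu / 2) - 1) by rewrite /a; ring.
  by rewrite expRD (powRDgt0 (- b) _ v0); ring.
rewrite ge0_integralZl_EFin//; first last.
- by rewrite mulr_ge0// ltW.
- apply/measurable_EFinP; apply: open_continuous_measurable_fun => // v.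
  rewrite inE/= in_itv/= andbT => v0.
  apply: cvgM; first exact: powR_continuous_at.
  apply: (cvg_comp (fun v : R => - (c / v)) expR); last exact: continuous_expR.
  apply: cvgN; apply: cvgM; first exact: cvg_cst.
  by apply: inv_continuous; rewrite gt_eqF.
- by move=> v _; rewrite lee_fin mulr_ge0 ?powR_ge0 ?expR_ge0.
by rewrite integral_inv_gamma// integral_gamma// -!EFinM !mulrA.
Qed.
End marginals.

Section model.
Context {R : realType} {n r1 r2 : nat} (Sigma : 'M[R]_n)
  (Xt : 'M[R]_(n, r1)) (Xg : 'M[R]_(n, r2)).
Hypotheses (pdSigma : posdefmx Sigma)
  (full_rank : \rank (row_mx Xt Xg) = (r1 + r2)%N)
  (orth : Xt^T *m invmx Sigma *m Xg = 0).

Let W := invmx Sigma.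
Let It := fisher_info Sigma Xt.
Let Ig := fisher_info Sigma Xg.
Let pdIt : posdefmx It := posdefmx_info_t pdSigma full_rank.
Let pdIg : posdefmx Ig := posdefmx_info_g pdSigma full_rank.

(** The normal equations make the residual e orthogonal to the columns of Xt and
of Xg, and these are orthogonal to each other, so Pythagoras applies twice. *)
Lemma residual_decomposition (y : 'cV_n) (t : 'cV_r1) (g : 'cV_r2) :
  qform W (y - (Xt *m t + Xg *m g)) =
  rss Sigma Xt Xg y + qform It (t - gls Sigma Xt y) + qform Ig (g - gls Sigma Xg y).
Proof.
have [sW _] := posdefmx_inv pdSigma.
set e := y - Xt *m gls Sigma Xt y - Xg *m gls Sigma Xg y.
have Xte : Xt^T *m W *m e = 0.
  rewrite /e !mulmxBr (mulmxA _ Xg) orth mul0mx subr0 /gls.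
  rewrite !mulmxA -/W -[Xt^T *m W *m Xt]/It.
  by rewrite mulmxV ?posdefmx_unit ?mul1mx ?subrr.
have Xge : Xg^T *m W *m e = 0.
  rewrite /e !mulmxBr (mulmxA _ Xt) (orth_tr pdSigma orth) mul0mx subr0 /gls.
  rewrite !mulmxA -/W -[Xg^T *m W *m Xg]/Ig.
  by rewrite mulmxV ?posdefmx_unit ?mul1mx ?subrr.
set dt := gls Sigma Xt y - t; set dg := gls Sigma Xg y - g.
have -> : y - (Xt *m t + Xg *m g) = (Xt *m dt + Xg *m dg) + e.
  rewrite /dt /dg /e !mulmxBr; move: (Xt *m gls _ _ _) (Xg *m gls _ _ _) => a b.
  by apply/matrixP => i j; rewrite !mxE; ring.
have N k (M : 'M[R]_k) (x z : 'cV_k) : qform M (x - z) = qform M (z - x).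
  by rewrite -[z - x]opprB -[- (x - z)]scaleN1r qformZr expr2 mulNr mul1r opprK mul1r.
have info r (X : 'M[R]_(n, r)) (x : 'cV_r) : qform W (X *m x) = qform (fisher_info Sigma X) x.
  by rewrite /qform /fisher_info trmx_mul !mulmxA.
rewrite (qformD_orth sW) -/W; last first.
  have -> : (Xt *m dt + Xg *m dg)^T = dt^T *m Xt^T + dg^T *m Xg^T.
    by rewrite -!trmx_mul -linearD.
  rewrite !mulmxDl -!(mulmxA _ _ W) -!(mulmxA _ _ e).
  by rewrite (mulmxA _ W) Xte (mulmxA _ W) Xge !mulmx0 addr0.
rewrite (qformD_orth sW); last first.
  by rewrite trmx_mul -!mulmxA (mulmxA _ W) (mulmxA _ Xg) orth mul0mx mulmx0.
rewrite !info (N _ _ t) (N _ _ g) -/dt -/dg addrC addrA.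
by rewrite /rss -/e.
Qed.

(** Up to a power of v and an exponential, the likelihood of either model with
gamma integrated out. *)
Let L := (2 * pi) `^ (- (n%:R / 2)) * (\det Sigma) `^ (- (1 / 2))
  * ((2 * pi) `^ (r2%:R / 2) * (\det Ig) `^ (- (1 / 2))) : R.
(** Minus the exponent of v that the likelihood keeps once gamma is integrated
out. *)
Let b : R := n%:R / 2 - r2%:R / 2.

Lemma likelihoodE (y : 'cV_n) (t : 'cV_r1) (g : 'cV_r2) (v : R) : 0 < v ->
  likelihood Sigma Xt Xg y t g v =
  (2 * pi) `^ (- (n%:R / 2)) * (v `^ (- (n%:R / 2)) * (\det Sigma) `^ (- (1 / 2)))
  * expR (- (rss Sigma Xt Xg y / (2 * v)))
  * expR (- (qform It (t - gls Sigma Xt y) / (2 * v)))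
  * expR (- (qform Ig (g - gls Sigma Xg y) / (2 * v))).
Proof.
move=> v0; rewrite /likelihood mvn_pdf_scaled// residual_decomposition.
by rewrite -!mulrA -!expRD; congr (_ * (_ * (_ * expR _))); ring.
Qed.

Lemma marginal0E (s0 nu0 : R) (y : 'cV_n) : (r1 + r2 < n)%N -> 0 < s0 -> 0 <= nu0 ->
  0 < rss Sigma Xt Xg y ->
  let a := b + nu0 / 2 in
  marginal0 Sigma Xt Xg s0 nu0 y =
  (L * kappa s0 nu0
   * ((s0 ^+ 2 * nu0 + (rss Sigma Xt Xg y + qform It (gls Sigma Xt y))) / 2) `^ (- a)
   * Gamma a)%:E.
Proof.
move=> rn s0_gt0 nu0_ge0 s2 a.
rewrite -integral_inv_chi2//.
- rewrite /marginal0; apply: eq_integral => v; rewrite inE/= in_itv/= andbT => v0.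
  (* C gathers the factors that do not depend on g. *)
  pose C := (2 * pi) `^ (- (n%:R / 2)) * (v `^ (- (n%:R / 2)) * (\det Sigma) `^ (- (1 / 2)))
    * expR (- ((rss Sigma Xt Xg y + qform It (gls Sigma Xt y)) / (2 * v)))
    * inv_chi2_pdf s0 nu0 v.
  transitivity (lebint (fun g => (C * expR (- (qform Ig (g - gls Sigma Xg y) / (2 * v))))%:E)).
    congr lebint; apply/funext => g; congr _%:E.
    rewrite likelihoodE// /C.
    have -> : qform It (0 - gls Sigma Xt y) = qform It (gls Sigma Xt y).
      by rewrite sub0r -scaleN1r qformZr expr2 mulNr mul1r opprK mul1r.
    by rewrite expRN_divD; ring.
  rewrite lebint_gauss_scaled//; last first.
    by rewrite !mulr_ge0 ?powR_ge0 ?expR_ge0 ?(ltW (kappa_gt0 _ _)).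
  have vb : v `^ (- b) = v `^ (- (n%:R / 2)) * v `^ (r2%:R / 2).
    by rewrite -powRDgt0//; congr powR; rewrite /b; ring.
  by congr _%:E; rewrite vb /C /L; ring.
- by rewrite !mulr_ge0 ?powR_ge0.
- by rewrite ltr_wpDr// qform_ge0.
- rewrite /b ltr_wpDr ?divr_ge0// -mulrBl divr_gt0// subr_gt0 ltr_nat.
  by rewrite (leq_ltn_trans _ rn)// leq_addl.
Qed.

(** Here the integral over theta comes first: it merges likelihood and prior by
[qform_complete_square], and its powers of 2 pi and v cancel those in the
normalization of the prior. *)
Lemma marginal1E (Omega : 'M[R]_r1) (s1 nu1 : R) (y : 'cV_n) : posdefmx Omega ->
  (r1 + r2 < n)%N -> 0 < s1 -> 0 <= nu1 ->
  0 < rss Sigma Xt Xg y ->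
  let a := b + nu1 / 2 in
  let J := invmx (invmx It + Omega) in
  marginal1 Sigma Xt Xg Omega s1 nu1 y =
  (L * ((\det Omega) `^ (- (1 / 2)) * (\det (It + invmx Omega)) `^ (- (1 / 2)))
   * kappa s1 nu1
   * ((s1 ^+ 2 * nu1 + (rss Sigma Xt Xg y + qform J (gls Sigma Xt y))) / 2) `^ (- a)
   * Gamma a)%:E.
Proof.
move=> pdO rn s1_gt0 nu1_ge0 s2 a J.
have pdP : posdefmx (It + invmx Omega).
  by apply: posdefmx_sum => //; exact: posdefmx_inv.
have pdJ : posdefmx J.
  by apply: posdefmx_inv; apply: posdefmx_sum => //; exact: posdefmx_inv.
have pi2 : 0 < 2 * pi :> R by rewrite mulr_gt0// pi_gt0.
set th := gls Sigma Xt y; set gh := gls Sigma Xg y.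
rewrite -integral_inv_chi2//.
- rewrite /marginal1; apply: eq_integral => v; rewrite inE/= in_itv/= andbT => v0.
  (* D gathers the factors that depend neither on g nor on t; E comes from the
     integral over t. *)
  pose D := (2 * pi) `^ (- (n%:R / 2)) * (v `^ (- (n%:R / 2)) * (\det Sigma) `^ (- (1 / 2)))
    * expR (- ((rss Sigma Xt Xg y + qform J th) / (2 * v)))
    * inv_chi2_pdf s1 nu1 v
    * ((2 * pi) `^ (- (r1%:R / 2)) * (v `^ (- (r1%:R / 2)) * (\det Omega) `^ (- (1 / 2)))).
  pose E := (2 * pi) `^ (r1%:R / 2) * v `^ (r1%:R / 2) * (\det (It + invmx Omega)) `^ (- (1 / 2)).
  have D0 : 0 <= D.
    by rewrite /D !mulr_ge0 ?powR_ge0 ?expR_ge0 ?(ltW (kappa_gt0 _ _)).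
  transitivity (lebint (fun g => (D * E * expR (- (qform Ig (g - gh) / (2 * v))))%:E)).
    congr lebint; apply/funext => g.
    transitivity (lebint (fun t => (D * expR (- (qform Ig (g - gh) / (2 * v)))
        * expR (- (qform (It + invmx Omega) (t - invmx (It + invmx Omega) *m It *m th) / (2 * v))))%:E)).
      congr lebint; apply/funext => t; congr _%:E.
      rewrite likelihoodE// mvn_pdf_scaled// subr0 -/th -/gh.
      have := qform_complete_square pdIt pdO t th; rewrite -/J.
      set q1 := qform It _; set q2 := qform (invmx Omega) _; set q3 := qform (It + _) _.
      move=> q123; have -> : q3 = q1 + q2 - qform J th by rewrite q123 addrK.
      have E3 : expR (- ((rss Sigma Xt Xg y + qform J th) / (2 * v)))
            * expR (- ((q1 + q2 - qform J th) / (2 * v)))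
          = expR (- (rss Sigma Xt Xg y / (2 * v))) * expR (- (q1 / (2 * v)))
            * expR (- (q2 / (2 * v))).
        by rewrite -!expRD; congr expR; field; rewrite gt_eqF.
      set e3 := expR _ in E3; set e4 := expR _ in E3.
      transitivity ((2 * pi) `^ (- (n%:R / 2))
        * (v `^ (- (n%:R / 2)) * (\det Sigma) `^ (- (1 / 2)))
        * inv_chi2_pdf s1 nu1 v
        * ((2 * pi) `^ (- (r1%:R / 2)) * (v `^ (- (r1%:R / 2)) * (\det Omega) `^ (- (1 / 2))))
        * expR (- (qform Ig (g - gh) / (2 * v))) * (e3 * e4)); last by rewrite /D /e3 /e4; ring.
      by rewrite E3; ring.
    rewrite (lebint_gauss_scaled _ pdP v0 (mulr_ge0 D0 (expR_ge0 _))) /E.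
    by congr _%:E; ring.
  have E0 : 0 <= E by rewrite /E !mulr_ge0 ?powR_ge0.
  rewrite (lebint_gauss_scaled _ pdIg v0 (mulr_ge0 D0 E0)).
  have vb : v `^ (- b) = v `^ (- (n%:R / 2)) * v `^ (r2%:R / 2).
    by rewrite -powRDgt0//; congr powR; rewrite /b; ring.
  have cancel_r1 (x : R) : 0 < x -> x `^ (- (r1%:R / 2)) * x `^ (r1%:R / 2) = 1.
    by move=> x0; rewrite -powRDgt0// addNr powRr0.
  congr _%:E; rewrite vb.
  transitivity (L * ((\det Omega) `^ (- (1 / 2)) * (\det (It + invmx Omega)) `^ (- (1 / 2)))
    * (v `^ (- (n%:R / 2)) * v `^ (r2%:R / 2))
    * expR (- ((rss Sigma Xt Xg y + qform J th) / (2 * v))) * inv_chi2_pdf s1 nu1 v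
    * ((2 * pi) `^ (- (r1%:R / 2)) * (2 * pi) `^ (r1%:R / 2))
    * (v `^ (- (r1%:R / 2)) * v `^ (r1%:R / 2))).
    by rewrite /D /E /L; ring.
  by rewrite !cancel_r1// !mulr1.
- by rewrite !mulr_ge0 ?powR_ge0.
- by rewrite ltr_wpDr// qform_ge0.
- rewrite /b ltr_wpDr ?divr_ge0// -mulrBl divr_gt0// subr_gt0 ltr_nat.
  by rewrite (leq_ltn_trans _ rn)// leq_addl.
Qed.
End model.

(** * The Bayes factor in closed form *)

Section bayes_factor_formula.
Context {R : realType} {n r1 r2 : nat} (Sigma : 'M[R]_n)
  (Xt : 'M[R]_(n, r1)) (Xg : 'M[R]_(n, r2)) (Omega : 'M[R]_r1) (s0 nu0 s1 nu1 : R).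
Hypotheses (ltn_r1r2_n : (r1 + r2 < n)%N)
  (pdSigma : posdefmx Sigma) (pdOmega : posdefmx Omega)
  (full_rank : \rank (row_mx Xt Xg) = (r1 + r2)%N)
  (orth : Xt^T *m invmx Sigma *m Xg = 0)
  (s0_gt0 : 0 < s0) (s1_gt0 : 0 < s1) (nu0_ge0 : 0 <= nu0) (nu1_ge0 : 0 <= nu1).

Let I := fisher_info Sigma Xt.
Let J := invmx (invmx I + Omega).
Let pdI : posdefmx I := posdefmx_info_t pdSigma full_rank.
Let pdIg : posdefmx (fisher_info Sigma Xg) := posdefmx_info_g pdSigma full_rank.
Let pdIO : posdefmx (Omega + invmx I).
Proof. by apply: posdefmx_sum => //; exact: posdefmx_inv. Qed.
Let pdP : posdefmx (I + invmx Omega).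
Proof. by apply: posdefmx_sum => //; exact: posdefmx_inv. Qed.
Let pdJ : posdefmx J.
Proof. by apply: posdefmx_inv; rewrite addrC. Qed.

Lemma exponent_gt0 (nu : R) : 0 <= nu -> 0 < (n%:R + nu - r2%:R) / 2.
Proof.
move=> nu_ge0; rewrite divr_gt0// subr_gt0 ltr_wpDr// ltr_nat.
by rewrite (leq_ltn_trans _ ltn_r1r2_n)// leq_addl.
Qed.

Lemma C1_gt0 : 0 < C1 n r2 I Omega s0 nu0 s1 nu1.
Proof.
by rewrite /C1 !mulr_gt0 ?powR_gt0 ?invr_gt0 ?mulr_gt0 ?kappa_gt0 ?Gamma_gt0
  ?exponent_gt0 ?det_posdefmx_gt0.
Qed.

Lemma bayes_factorE (y : 'cV_n) : 0 < rss Sigma Xt Xg y ->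
  bayes_factor Sigma Xt Xg Omega s0 nu0 s1 nu1 y = C1 n r2 I Omega s0 nu0 s1 nu1
  * ((s1 ^+ 2 * nu1 + rss Sigma Xt Xg y + qform J (gls Sigma Xt y))
       `^ (- ((n%:R + nu1 - r2%:R) / 2))
     / (s0 ^+ 2 * nu0 + rss Sigma Xt Xg y + qform I (gls Sigma Xt y))
         `^ (- ((n%:R + nu0 - r2%:R) / 2))).
Proof.
move=> s2; rewrite /bayes_factor (marginal0E pdSigma full_rank orth)//.
rewrite (marginal1E pdSigma full_rank orth)//= -/I -/J !addrA.
have qI := qform_ge0 (gls Sigma Xt y) pdI; have qJ := qform_ge0 (gls Sigma Xt y) pdJ.
set S0 := s0 ^+ 2 * nu0 + _ + _; set S1 := s1 ^+ 2 * nu1 + _ + _.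
have S0_gt0 : 0 < S0 by rewrite ltr_wpDr// ltr_wpDl// mulr_ge0// sqr_ge0.
have S1_gt0 : 0 < S1 by rewrite ltr_wpDr// ltr_wpDl// mulr_ge0// sqr_ge0.
have aE nu : n%:R / 2 - r2%:R / 2 + nu / 2 = (n%:R + nu - r2%:R) / 2 :> R by field.
rewrite !aE; set p0 := (n%:R + nu0 - _) / 2; set p1 := (n%:R + nu1 - _) / 2.
have half S p : 0 < S -> (S / 2) `^ (- p) = S `^ (- p) * 2 `^ p :> R.
  move=> S_gt0; rewrite powRM ?invr_ge0 ?ltW//; congr (_ * _).
  by rewrite -[2^-1]powR_inv1// -powRrM mulN1r opprK.
have detE h : (\det Omega) `^ h * (\det (I + invmx Omega)) `^ h
    = (\det (Omega + invmx I)) `^ h * (\det I) `^ h.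
  by rewrite -!powRM ?ltW ?det_posdefmx_gt0// det_precision.
rewrite !half// detE /C1 -/p0 -/p1.
have p10 : (nu1 - nu0) / 2 = p1 - p0 by rewrite /p1 /p0; field.
rewrite p10 [2 `^ (p1 - p0)]powRB ?pnatr_eq0 ?implybT//.
have G0 : 0 < Gamma p0 by rewrite Gamma_gt0 ?exponent_gt0.
have k0 := kappa_gt0 nu0 s0_gt0.
have S0p := powR_gt0 (- p0) S0_gt0; have two0 : 0 < 2 `^ p0 :> R by rewrite powR_gt0.
set L := _ * \det Sigma `^ _ * _.
have L0 : 0 < L.
  by rewrite /L !mulr_gt0 ?powR_gt0 ?det_posdefmx_gt0// mulr_gt0 ?pi_gt0.
move: L L0 (\det _ `^ _) (\det I `^ _) => L L0 d1 d2.
move: (kappa _ _) k0 (kappa _ _) => k0 k0_gt0 k1.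
move: (Gamma _) G0 (Gamma _) (_ `^ _) S0p => G0 G0_gt0 G1 T0 T0_gt0.
move: (2 `^ _) two0 (2 `^ _) (_ `^ _) => t0 t0_gt0 t1 T1.
by field; rewrite !gt_eqF.
Qed.
End bayes_factor_formula.

(** * Limits along far data sets *)

Section limf_esup_bounds.
Context {R : realType} {T : topologicalType}.
Implicit Types (f : T -> \bar R) (F : set_system T).

Lemma limf_esup_le f F A (x : \bar R) : F A -> (forall y, A y -> (f y <= x)%E) ->
  (limf_esup f F <= x)%E.
Proof.
move=> FA fx; rewrite limf_esupE; apply: (@le_trans _ _ (ereal_sup (f @` A))).
  by apply: ereal_inf_lbound; exists A.
by apply: ge_ereal_sup => _ [y Ay <-]; exact: fx.
Qed.

Lemma limf_esup_ge f F (x : \bar R) : (forall A, F A -> exists2 y, A y & (x <= f y)%E) ->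
  (x <= limf_esup f F)%E.
Proof.
move=> Fx; rewrite limf_esupE; apply: le_ereal_inf_tmp => _ [A FA <-].
by have [y Ay xfy] := Fx _ FA; apply: le_ereal_sup_tmp; exists (f y) => //; exists y.
Qed.
End limf_esup_bounds.

Section far_data_filter.
Context {R : realType} {n r1 r2 : nat} (Sigma : 'M[R]_n)
  (Xt : 'M[R]_(n, r1)) (Xg : 'M[R]_(n, r2)) (s : R).

Lemma far_data_filter : Filter (far_data Sigma Xt Xg s).
Proof.
apply: filter_from_filter; first by exists 0.
move=> M N _ _; exists (Num.max M N) => // y [ys /=].
by rewrite gt_max => /andP[My Ny].
Qed.

Lemma far_data_rss : \forall y \near far_data Sigma Xt Xg s, rss Sigma Xt Xg y = s.
Proof. by exists 0 => // y []. Qed.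

Lemma l2norm_ge0 k (x : 'cV[R]_k) : 0 <= l2norm x.
Proof. exact: sqrtr_ge0. Qed.

Lemma sqr_l2norm k (x : 'cV[R]_k) : l2norm x ^+ 2 = \sum_i x i ord0 ^+ 2.
Proof. by rewrite sqr_sqrtr// sumr_ge0// => i _; exact: sqr_ge0. Qed.

(** A definite form dominates the squared norm, hence tends to infinity with it. *)
Lemma far_data_qform (A : 'M[R]_r1) (M : R) : posdefmx A ->
  \forall y \near far_data Sigma Xt Xg s, M < qform A (gls Sigma Xt y).
Proof.
move=> pdA; have [d d0 dA] := qform_dominated 1%:M pdA.
(* The norm exceeds 1, so its square exceeds it. *)
exists (1 + `|d * M|) => // y [_ /=]; set x := gls _ _ _ => Mx.
have x1 : 1 < l2norm x by rewrite (le_lt_trans _ Mx)// lerDl.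
rewrite -(ltr_pM2l d0) (lt_le_trans _ (dA x))//.
have -> : qform 1%:M x = l2norm x ^+ 2.
  rewrite sqr_l2norm /qform mulmx1 mxE; apply: eq_bigr => i _.
  by rewrite mxE expr2.
rewrite (le_lt_trans (ler_norm _))// (@lt_trans _ _ (l2norm x))//.
  by rewrite (le_lt_trans _ Mx)// lerDr.
by rewrite expr2 ltr_pMr// (lt_trans _ x1).
Qed.

Lemma l2normZ k (c : R) (x : 'cV[R]_k) : 0 <= c -> l2norm (c *: x) = c * l2norm x.
Proof.
move=> c0; rewrite /l2norm.
under eq_bigr do rewrite mxE exprMn.
by rewrite -mulr_sumr sqrtrM ?sqr_ge0// sqrtr_sqr ger0_norm.
Qed.

Lemma l2norm_gt0 k (x : 'cV[R]_k) : x != 0 -> 0 < l2norm x.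
Proof.
move=> x0; rewrite lt_neqAle l2norm_ge0 andbT eq_sym -sqrf_eq0 sqr_l2norm.
rewrite psumr_eq0; last by move=> i _; exact: sqr_ge0.
apply: contra x0 => /allP h; apply/eqP/matrixP => i j; rewrite ord1 [RHS]mxE.
by apply/eqP; rewrite -sqrf_eq0; apply: h; rewrite mem_index_enum.
Qed.
End far_data_filter.

Section power_ratio.
Context {R : realType} {T : Type} {F : set_system T} {FF : Filter F}.
Implicit Types (u v : T -> R) (a b K p q : R).

Lemma powR_lt_root (d X x : R) : 0 < d -> 0 <= X -> X `^ d^-1 < x -> X < x `^ d.
Proof.
move=> d0 X0 Xx; have -> : X = (X `^ d^-1) `^ d.
  by rewrite -powRrM mulVf ?gt_eqF// powRr1.
by rewrite gt0_ltr_powR ?nnegrE ?powR_ge0// ltW// (le_lt_trans _ Xx)// powR_ge0.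
Qed.

Lemma affine_dominated a b K (x y : R) : 0 <= a -> 0 < b -> 0 <= K -> 0 <= y ->
  x <= K * y -> a + x <= (a / b + K) * (b + y).
Proof.
move=> a0 b0 K0 y0 xKy.
have -> : (a / b + K) * (b + y) = a + K * y + (a / b * y + K * b).
  by field; rewrite gt_eqF.
rewrite ler_wpDr ?lerD2l// addr_ge0// mulr_ge0 ?divr_ge0 ?(ltW b0)//.
Qed.

(** As a + u is at most k (b + v), the ratio is at most k^p (b + v)^(p - q). *)
Lemma power_ratio_cvg0 u v a b K p q : 0 < a -> 0 < b -> 0 <= K -> 0 < p -> p < q ->
  (forall y, 0 <= u y) -> (forall y, 0 <= v y) -> (forall y, u y <= K * v y) ->
  v y @[y --> F] --> +oo ->
  (a + u y) `^ p / (b + v y) `^ q @[y --> F] --> (0 : R).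
Proof.
move=> a0 b0 K0 p0 pq u0 v0 uKv /cvgryPgt vy.
have d0 : 0 < q - p by rewrite subr_gt0.
set k := a / b + K; have k0 : 0 <= k by rewrite addr_ge0 ?divr_ge0// ltW.
apply/cvgrPdist_lt => e e0; pose X := k `^ p / e.
have X0 : 0 <= X by rewrite divr_ge0 ?powR_ge0// ltW.
near=> y.
have vX : X `^ (q - p)^-1 < v y by near: y; exact: vy.
have bv0 : 0 < b + v y by rewrite ltr_wpDr.
have bvX : X < (b + v y) `^ (q - p).
  by apply: powR_lt_root => //; rewrite (lt_le_trans vX)// lerDr ltW.
have au0 : 0 <= a + u y by rewrite addr_ge0// ltW.
have auk : a + u y <= k * (b + v y) by apply: affine_dominated => //; rewrite ltW.
rewrite sub0r normrN ger0_norm ?divr_ge0 ?powR_ge0//.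
have qE : (b + v y) `^ q = (b + v y) `^ (q - p) * (b + v y) `^ p.
  by rewrite -powRDgt0// subrK.
rewrite ltr_pdivrMr ?powR_gt0// qE mulrA.
apply: (@le_lt_trans _ _ (k `^ p * (b + v y) `^ p)).
  rewrite -powRM// ?(ltW bv0)// ge0_ler_powR// ?nnegrE// ?(ltW p0)//.
  by rewrite mulr_ge0// ltW.
by rewrite ltr_pM2r ?powR_gt0// mulrC -ltr_pdivrMr.
Unshelve. all: by end_near. Qed.

(** The inverse ratio has the shape of [power_ratio_cvg0]. *)
Lemma power_ratio_cvgy u v a b K p q : 0 < a -> 0 < b -> 0 <= K -> 0 < q -> q < p ->
  (forall y, 0 <= u y) -> (forall y, 0 <= v y) -> (forall y, v y <= K * u y) ->
  u y @[y --> F] --> +oo ->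
  (a + u y) `^ p / (b + v y) `^ q @[y --> F] --> +oo.
Proof.
move=> a0 b0 K0 q0 qp u0 v0 vKu uy; apply/gtr0_cvgV0.
  by near=> y; rewrite divr_gt0 ?powR_gt0 ?ltr_wpDr.
have := power_ratio_cvg0 b0 a0 K0 q0 qp v0 u0 vKu uy.
apply: cvg_trans; apply: near_eq_cvg; near=> y.
by rewrite /= invf_div.
Unshelve. all: by end_near. Qed.

(** Once v exceeds a / d, the constant a is at most d v, and then a + u is at
most (K + d) (b + v); d is chosen by continuity of the power at K. *)
Lemma power_ratio_limsup u v a b K p e : 0 < a -> 0 < b -> 0 < K -> 0 < p -> 0 < e ->
  (forall y, 0 <= u y) -> (forall y, 0 <= v y) -> (forall y, u y <= K * v y) ->
  v y @[y --> F] --> +oo ->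
  \forall y \near F, (a + u y) `^ p / (b + v y) `^ p <= K `^ p + e.
Proof.
move=> a0 b0 K0 p0 e0 u0 v0 uKv /cvgryPgt vy.
have [d d0 dK] : exists2 d, 0 < d & (K + d) `^ p <= K `^ p + e.
  have /cvgrPdist_le /(_ e e0) := @powR_continuous_at _ p K K0.
  move=> [r /= r0 rK]; exists (r / 2); first by rewrite divr_gt0.
  have r20 : 0 < r / 2 by rewrite divr_gt0.
  have /= := rK (K + r / 2); rewrite opprD addNKr normrN gtr0_norm// => h.
  have : `|K `^ p - (K + r / 2) `^ p| <= e.
    by apply: h; rewrite ltr_pdivrMr// ltr_pMr// ltr1n.
  by rewrite ler_distlC => /andP[_].
near=> y.
have av : a / d < v y by near: y; exact: vy.
have bv0 : 0 < b + v y by rewrite ltr_wpDr.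
have au0 : 0 < a + u y by rewrite ltr_wpDr.
apply: le_trans dK.
have Kd0 : 0 < K + d by rewrite addr_gt0.
rewrite ler_pdivrMr ?powR_gt0// -powRM ?(ltW bv0) ?(ltW Kd0)//.
rewrite ge0_ler_powR ?nnegrE ?(ltW p0) ?(ltW au0)//.
  by rewrite mulr_ge0 ?(ltW bv0) ?(ltW Kd0).
have avd : a <= d * v y by rewrite mulrC -ler_pdivrMr// ltW.
have := uKv y; have := v0 y; nra.
Unshelve. all: by end_near. Qed.
End power_ratio.

(** * Asymptotics of the Bayes factor *)

Theorem lemma1 (R : realType) (n r1 r2 : nat)
  (Xt : 'M[R]_(n, r1)) (Xg : 'M[R]_(n, r2))
  (Sigma : 'M[R]_n) (Omega : 'M[R]_r1) (s0 nu0 s1 nu1 : R)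
  (r1_gt0 : (0 < r1)%N) (ltn_r1r2_n : (r1 + r2 < n)%N)
  (pdSigma : posdefmx Sigma) (pdOmega : posdefmx Omega)
  (full_rank : \rank (row_mx Xt Xg) = (r1 + r2)%N)
  (orth : Xt^T *m invmx Sigma *m Xg = 0)
  (s0_gt0 : 0 < s0) (s1_gt0 : 0 < s1) (nu0_ge0 : 0 <= nu0) (nu1_ge0 : 0 <= nu1) :
  let I := fisher_info Sigma Xt in
  let J := invmx (invmx I + Omega) in
  let C := C1 n r2 I Omega s0 nu0 s1 nu1 in
  let th := gls Sigma Xt in
  let s2 := rss Sigma Xt Xg in
  let B10 := bayes_factor Sigma Xt Xg Omega s0 nu0 s1 nu1 in
  (forall y, 0 < s2 y ->
     B10 y = C
       * ((s1 ^+ 2 * nu1 + s2 y + qform J (th y))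
            `^ (- ((n%:R + nu1 - r2%:R) / 2))
          / (s0 ^+ 2 * nu0 + s2 y + qform I (th y))
              `^ (- ((n%:R + nu0 - r2%:R) / 2)))) /\
  forall s : R, 0 < s ->
  let F := far_data Sigma Xt Xg s in
  [/\ nu0 < nu1 -> B10 y @[y --> F] --> (0 : R),
      nu1 < nu0 -> B10 y @[y --> F] --> +oo
    & forall nu, nu0 = nu -> nu1 = nu ->
      let p := (n%:R + nu - r2%:R) / 2 in
      let L := limf_esup (fun y => (qform I (th y) / qform J (th y))%:E) F in
      exists2 lmax : R, largest_eigenvalue (I *m Omega) lmax &
      [/\ (limf_esup (fun y => (B10 y)%:E) F <= C%:E * L `^ p)%E,
          (C%:E * L `^ p = (C * (1 + lmax) `^ p)%:E)%E
        & ((C * (1 + lmax) `^ p)%:E < +oo)%E]].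
Proof.
move=> I J C th s2 B10.
have B10E y : 0 < s2 y -> B10 y = C
    * ((s1 ^+ 2 * nu1 + s2 y + qform J (th y)) `^ (- ((n%:R + nu1 - r2%:R) / 2))
       / (s0 ^+ 2 * nu0 + s2 y + qform I (th y)) `^ (- ((n%:R + nu0 - r2%:R) / 2))).
  exact: bayes_factorE.
split=> // s s_gt0 F.
have pdI : posdefmx I := posdefmx_info_t pdSigma full_rank.
have pdJ : posdefmx J.
  by apply: posdefmx_inv; apply: posdefmx_sum => //; exact: posdefmx_inv.
have C_gt0 : 0 < C by apply: (C1_gt0 ltn_r1r2_n pdSigma pdOmega full_rank).
have [l [x [eig_l x0 Ix IJ]]] := rayleigh_largest_eigenvalue r1_gt0 pdI pdOmega.
rewrite -/J in Ix IJ; set K := 1 + l in Ix IJ.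
have K_gt0 : 0 < K.
  by move: (posdefmx_gt0 x pdI); rewrite x0 Ix pmulr_lgt0// posdefmx_gt0.
have [c c_gt0 JI] := qform_dominated J pdI.
pose a0 := s0 ^+ 2 * nu0 + s; pose a1 := s1 ^+ 2 * nu1 + s.
have a0_gt0 : 0 < a0 by rewrite ltr_wpDl// mulr_ge0// sqr_ge0.
have a1_gt0 : 0 < a1 by rewrite ltr_wpDl// mulr_ge0// sqr_ge0.
pose qI y := qform I (th y); pose qJ y := qform J (th y).
have qI_ge0 y : 0 <= qI y by exact: qform_ge0.
have qJ_ge0 y : 0 <= qJ y by exact: qform_ge0.
set p0 := (n%:R + nu0 - r2%:R) / 2 in B10E.
set p1 := (n%:R + nu1 - r2%:R) / 2 in B10E.
have p0_gt0 : 0 < p0 by exact: (exponent_gt0 ltn_r1r2_n nu0_ge0).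
have p1_gt0 : 0 < p1 by exact: (exponent_gt0 ltn_r1r2_n nu1_ge0).
have FF : Filter F by exact: far_data_filter.
(* Both exponents of the closed form are negative: the quotient is inverted. *)
have B10F : {near F, (fun y => C * ((a0 + qI y) `^ p0 / (a1 + qJ y) `^ p1)) =1 B10}.
  have F_s : \forall y \near F, s2 y = s by exact: far_data_rss.
  by near=> y; rewrite B10E (near F_s y)// !powRN invrK [X in _ * X]mulrC.
have I_y : qI y @[y --> F] --> +oo.
  by apply/cvgryPgt => M; exact: far_data_qform.
have J_y : qJ y @[y --> F] --> +oo.
  by apply/cvgryPgt => M; exact: far_data_qform.
split=> [nu01|nu10|nu nu0E nu1E p L].
- apply: (cvg_trans (near_eq_cvg B10F)); rewrite -(mulr0 C); apply: cvgMr.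
  apply: (power_ratio_cvg0 a0_gt0 a1_gt0 (ltW K_gt0) p0_gt0 _
    qI_ge0 qJ_ge0 (fun y => IJ (th y)) J_y).
  by rewrite /p0 /p1 ltr_pM2r// ltrD2r ltrD2l.
- apply: (cvg_trans (near_eq_cvg B10F)); apply: (cvg_comp _ ( *%R C)); last exact: gt0_cvgMry C_gt0 cvg_id.
  apply: (power_ratio_cvgy a0_gt0 a1_gt0 (ltW c_gt0) p1_gt0 _
    qI_ge0 qJ_ge0 (fun y => JI (th y)) I_y).
  by rewrite /p0 /p1 ltr_pM2r// ltrD2r ltrD2l.
have p0E : p0 = p by rewrite /p0 nu0E.
have p1E : p1 = p by rewrite /p1 nu1E.
have LE : L = K%:E.
  apply/eqP; rewrite eq_le; apply/andP; split.
    apply: (@limf_esup_le _ _ _ _ [set y | 0 < qJ y]).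
      exact: (far_data_qform Sigma Xt Xg s 0 pdJ).
    by move=> y qJy; rewrite lee_fin ler_pdivrMr//; exact: IJ.
  apply: limf_esup_ge => A [M _ MA].
  (* The ratio of the forms is constant on the line of the maximizer x, which
     therefore attains the bound arbitrarily far away. *)
  pose k := (`|M| + 1) / l2norm x.
  have k_gt0 : 0 < k by rewrite divr_gt0 ?l2norm_gt0// ltr_wpDl.
  have [y yx ys] := gls_rss_surj pdSigma full_rank orth (k *: x) ltn_r1r2_n s_gt0.
  exists y.
    apply: MA; split=> //; rewrite yx l2normZ ?(ltW k_gt0)//.
    rewrite divfK ?gt_eqF ?l2norm_gt0//.
    by rewrite (le_lt_trans (ler_norm M))// ltrDl.
  rewrite lee_fin /th yx !qformZr Ix -/(K * _).
  by rewrite mulrCA mulfK// mulf_neq0// gt_eqF// ?exprn_gt0// posdefmx_gt0.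
exists l => //; rewrite LE -/K; split; last exact: ltry; last first.
  by rewrite poweR_EFin EFinM.
rewrite poweR_EFin -EFinM; apply/lee_addgt0Pr => e e_gt0.
have eC_gt0 : 0 < e / C by rewrite divr_gt0.
have p_gt0 : 0 < p by rewrite -p0E.
have near_le := power_ratio_limsup a0_gt0 a1_gt0 K_gt0 p_gt0 eC_gt0 qI_ge0 qJ_ge0
  (fun y => IJ (th y)) J_y.
apply: (@limf_esup_le _ _ _ _
  [set y | (a0 + qI y) `^ p / (a1 + qJ y) `^ p <= K `^ p + e / C
    /\ C * ((a0 + qI y) `^ p0 / (a1 + qJ y) `^ p1) = B10 y]).
  by apply: filterI => //; exact: near_le.
move=> y [ey <-]; rewrite p0E p1E -EFinD lee_fin.
by rewrite (le_trans (ler_wpM2l (ltW C_gt0) ey))// mulrDr [C * (e / C)]mulrC divfK// gt_eqF.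
Unshelve. all: by end_near. Qed.
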